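(* Let $(M,F)$ be a Finsler manifold with a concurrent $\pi$-vector field $\overline A$, $\mathbf B:=i_{\overline A}\,g$ its associated $\pi$-form, $\mathfrak B:=\mathbf B(\overline\eta)$, $A^2:=g(\overline A,\overline A)$, and let $\widetilde F=\frac{\mathfrak B^2}{F}-F-\mathfrak B$ be the special golden Finsler metric. Then the canonical spray $\widetilde G$ of $\widetilde F$ is related to the canonical spray $G$ of $F$ by $$\widetilde G=G-\mathcal E_1\,\mathcal C-\mathcal E_2\,\gamma\overline A,$$ where $$\mathcal E_1:=\frac{F^2(F^3+3F\mathfrak B^2-4\mathfrak B^3)}{(\mathfrak B^2-\mathfrak BF-F^2)\,\mathcal Z},\qquad \mathcal E_2:=\frac{2F^4}{\mathcal Z},\qquad \mathcal Z:=F^2(1-2A^2)+3\mathfrak B^2.$$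
   Context: $\pi:TM\to M$ is the tangent bundle; $\pi$-vector fields (barred) are sections of the pullback bundle $\pi^{-1}(TM)$. $\gamma:\pi^{-1}(TM)\to TTM$ is the natural injection onto the vertical bundle (vertical lift), $\rho=(\pi_{TM},d\pi):TTM\to\pi^{-1}(TM)$, $J=\gamma\circ\rho$, $d_Jf=df\circ J$, $\overline\eta(u)=(u,u)$, and $\mathcal C=\gamma\overline\eta$ is the Liouville vector field. A Finsler metric $F:TM\to[0,\infty)$ is continuous, smooth and positive off the zero section, positively homogeneous of degree $1$ in $y$, with $\Omega=\frac12dd_JF^2$ of maximal rank; its metric tensor is $g(\rho X,\rho Y)=\Omega(JX,Y)$, i.e. $g_{ij}=\frac12\frac{\partial^2F^2}{\partial y^i\partial y^j}$. A conic Finsler metric satisfies these on an open conic subset of the slit tangent bundle. The canonical spray $G$ of $F$ is the vector field with $JG=\mathcal C$, $[\mathcal C,G]=G$, $i_Gdd_JF^2=-dF^2$. Let $\nabla$ and $D^\circ$ be the Cartan and Berwald connections of $F$ on $\pi^{-1}(TM)$ and $\beta$ the associated horizontal map (horizontal lift $\pi^{-1}(TM)\to H(TM)$). A non-vanishing $\pi$-vector field $\overline A$ is concurrent if, for all $\overline Z$, $\nabla_{\beta\overline Z}\overline A=-\overline Z=D^\circ_{\beta\overline Z}\overline A$ and $\nabla_{\gamma\overline Z}\overline A=0=D^\circ_{\gamma\overline Z}\overline A$. (Then $\overline A$ and $\mathbf B$ are independent of $y$.) The golden metric $\widetilde F$ is called special when it is built from a concurrent $\overline A$. Standing assumption: $\widetilde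 F$ is considered on an open conic set where it is a (conic) Finsler metric; in particular $\widetilde F\ne0$ and $\mathcal Z\neq0$ there. *)

(* Defs.v *)
From HB Require Import structures.
From mathcomp Require Import all_boot all_order all_algebra.
From mathcomp Require Import all_classical all_reals all_analysis.

Set Implicit Arguments.
Unset Strict Implicit.
Unset Printing Implicit Defensive.

Import Order.TTheory GRing.Theory Num.Theory.
Import numFieldNormedType.Exports.

Local Open Scope classical_set_scope.
Local Open Scope ring_scope.

(* C^oo on a set [S], which is open in every use below.  For finite-dimensional
   [U], differentiability of all iterated directional derivatives is the usual
   existence and continuity of all partial derivatives of every order. *)
Fixpoint iter_derive (R : realType) (U W : normedModType R)
    (vs : seq U) (f : U -> W) : U -> W :=
  if vs is v :: vs' then fun x => 'D_v (iter_derive vs' f) x else f.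

Definition smooth_on (R : realType) (U W : normedModType R)
    (S : set U) (f : U -> W) : Prop :=
  forall (vs : seq U) (x : U), S x -> differentiable (iter_derive vs f) x.

(* [param] inverts [coord] on the chart domain [dom]; its values outside
   [coord @` dom] are irrelevant. *)
Record chart (T : Type) (V : Type) := Chart {
  dom : set T;
  coord : T -> V;
  param : V -> T
}.

(* The points of a space together with an atlas and a preferred chart around
   each point.  A tangent vector at [x] is encoded by its components, an element
   of the model space [V], in the preferred chart at [x]. *)
Record charted (R : realType) (V : normedModType R) := Charted {
  pt :> Type;
  atlas : set (chart pt V);
  chart_at : pt -> chart pt V
}.

Section Charted.
Context {R : realType} {V : normedModType R} (N : charted V).

(* Openness for the topology induced by the atlas. *)
Definition mopen (S : set N) : Prop :=
  forall c, atlas c -> open (coord c @` (S `&` dom c)).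

Definition near_pt (P : set N -> Prop) (x : N) : Prop :=
  exists S : set N, [/\ mopen S, S x & P S].

Record smooth_manifold : Prop := SmoothManifold {
  mfd_chart_at : forall x : N, atlas (chart_at x) /\ dom (chart_at x) x;
  mfd_paramK : forall (c : chart N V) (x : N),
    atlas c -> dom c x -> param c (coord c x) = x;
  mfd_overlap : forall c c' : chart N V, atlas c -> atlas c' ->
    open (coord c @` (dom c `&` dom c'));
  mfd_transition : forall c c' : chart N V, atlas c -> atlas c' ->
    smooth_on (coord c @` (dom c `&` dom c')) (coord c' \o param c);
  mfd_hausdorff : forall x y : N, x <> y ->
    exists S S' : set N, [/\ mopen S, mopen S', S x, S' y & S `&` S' = set0];
  mfd_second_countable : exists A : set (chart N V),
    [/\ countable A, A `<=` atlas (c := N) &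
        forall x : N, exists2 c, A c & dom c x]
}.

(* Change of components of tangent vectors: from the preferred chart at [x] to
   the chart [c], and back at the point with coordinates [p] in [c]. *)
Definition to_chart (c : chart N V) (x : N) (v : V) : V :=
  'D_v (coord c \o param (chart_at x)) (coord (chart_at x) x).

Definition of_chart (c : chart N V) (p : V) (v : V) : V :=
  'D_v (coord (chart_at (param c p)) \o param c) p.

Definition smooth_fun (S : set N) (f : N -> R) : Prop :=
  forall c, atlas c -> smooth_on (coord c @` (S `&` dom c)) (f \o param c).

Definition vf_rep (c : chart N V) (X : N -> V) (p : V) : V :=
  to_chart c (param c p) (X (param c p)).

Definition smooth_vf (S : set N) (X : N -> V) : Prop :=
  forall c, atlas c -> smooth_on (coord c @` (S `&` dom c)) (vf_rep c X).

Definition dfun (f : N -> R) (x : N) (v : V) : R :=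
  'D_v (f \o param (chart_at x)) (coord (chart_at x) x).

Definition lie_bracket (X Y : N -> V) (x : N) : V :=
  let c := chart_at x in
  'D_(X x) (vf_rep c Y) (coord c x) - 'D_(Y x) (vf_rep c X) (coord c x).

(* Exterior derivative of a 1-form, on vectors extended with constant
   components in the preferred chart, so that the bracket term vanishes. *)
Definition ext_d (theta : N -> V -> R) (x : N) (X Y : V) : R :=
  let c := chart_at x in
  let rep (v : V) (p : V) : R := theta (param c p) (of_chart c p v) in
  'D_X (rep Y) (coord c x) - 'D_Y (rep X) (coord c x).

Definition tangent_chart (c : chart N V) : chart (N * V)%type (V * V)%type :=
  Chart [set u : N * V | dom c u.1]
        (fun u => (coord c u.1, to_chart c u.1 u.2))
        (fun q => (param c q.1, of_chart c q.1 q.2)).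

Definition tangent : charted (V * V)%type :=
  Charted (tangent_chart @` atlas (c := N)) (fun u => tangent_chart (chart_at u.1)).

End Charted.

Section Finsler.
Context {R : realType} {n : nat} (M : charted 'rV[R]_n).

Let V := 'rV[R]_n.
Let TM := tangent M.

Definition slit : set TM := [set u | u.2 != 0].

Definition dilate (a : R) (u : TM) : TM := (u.1, a *: u.2).

(* A pi-vector field is a function [TM -> V]: its value at [u] lies in the
   tangent space of [M] at [u.1]. *)
Definition smooth_pivf (S : set TM) (Y : TM -> V) : Prop :=
  forall c, atlas c ->
    smooth_on (coord (tangent_chart c) @` (S `&` dom (tangent_chart c)))
      (fun q => let u := param (tangent_chart c) q in to_chart c u.1 (Y u)).

(* The preferred chart of TM at [u] is induced by the preferred chart of [M] at
   [u.1], so a vector of T_u TM is a pair (x-components, y-components). *)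
Definition gam (v : V) : V * V := (0, v).
Definition rho (X : V * V) : V := X.1.
Definition J (X : V * V) : V * V := gam (rho X).
Definition etabar (u : TM) : V := u.2.
Definition liouville (u : TM) : V * V := gam (etabar u).

Definition dJ (f : TM -> R) (u : TM) (X : V * V) : R := dfun f u (J X).
Definition ddJ (f : TM -> R) : TM -> V * V -> V * V -> R := ext_d (dJ f).

Definition sq (F : TM -> R) (u : TM) : R := F u ^+ 2.

Definition Omega (F : TM -> R) (u : TM) (X Y : V * V) : R :=
  2^-1 * ddJ (sq F) u X Y.

(* g(rho X, rho Y) = Omega(JX, Y); as Omega vanishes on pairs of vertical
   vectors, any lift of [w] to T_u TM gives the same value. *)
Definition gmet (F : TM -> R) (u : TM) (v w : V) : R :=
  Omega F u (gam v) (w, 0).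

Record conic_finsler (S : set TM) (F : TM -> R) : Prop := ConicFinsler {
  cf_open : mopen S;
  cf_slit : S `<=` slit;
  cf_conic : forall (a : R) (u : TM), 0 < a -> S u -> S (dilate a u);
  cf_smooth : smooth_fun S F;
  cf_pos : forall u, S u -> 0 < F u;
  cf_homog : forall (a : R) (u : TM), 0 < a -> S u -> F (dilate a u) = a * F u;
  cf_rank : forall u, S u ->
    forall X, (forall Y, Omega F u X Y = 0) -> X = 0
}.

Record finsler (F : TM -> R) : Prop := Finsler {
  fin_ge0 : forall u, 0 <= F u;
  fin_continuous : forall c, atlas (c := TM) c ->
    forall q, (coord c @` dom c) q -> {for q, continuous (F \o param c)};
  fin_homog : forall (a : R) (u : TM), 0 < a -> F (dilate a u) = a * F u;
  fin_slit : conic_finsler slit F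
}.

Record canonical_spray (S : set TM) (F : TM -> R) (G : TM -> V * V) : Prop :=
  CanonicalSpray {
  spray_smooth : smooth_vf S G;
  spray_J : forall u, S u -> J (G u) = liouville u;
  spray_homog : forall u, S u -> lie_bracket (N := TM) liouville G u = G u;
  spray_eq : forall u, S u ->
    forall X, ddJ (sq F) u (G u) X = - dfun (sq F) u X
}.

(* [D u X Y] is the covariant derivative at [u] of the section [Y] along the
   vector [X] of T_u TM.  The axioms only concern sections that are smooth near
   [u]; the Leibniz rule forces the value to depend on the germ of [Y] only. *)
Definition pre_connection := TM -> V * V -> (TM -> V) -> V.

Record connection (D : pre_connection) : Prop := Connection {
  conn_linear : forall u Y, slit u -> near_pt (fun S => smooth_pivf S Y) u ->
    forall (a : R) (X X' : V * V),
      D u (a *: X + X') Y = a *: D u X Y + D u X' Y;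
  conn_add : forall u Y Z, slit u ->
    near_pt (fun S => smooth_pivf S Y) u ->
    near_pt (fun S => smooth_pivf S Z) u ->
    forall X, D u X (fun w => Y w + Z w) = D u X Y + D u X Z;
  conn_leibniz : forall u f Y, slit u ->
    near_pt (fun S => smooth_fun S f) u ->
    near_pt (fun S => smooth_pivf S Y) u ->
    forall X, D u X (fun w => f w *: Y w) = dfun f u X *: Y u + f u *: D u X Y;
  conn_smooth : forall u (X : TM -> V * V) Y, slit u ->
    near_pt (fun S => smooth_vf S X) u ->
    near_pt (fun S => smooth_pivf S Y) u ->
    near_pt (fun S => smooth_pivf S (fun w => D w (X w) Y)) u
}.

Definition horizontal (D : pre_connection) (u : TM) (X : V * V) : Prop :=
  D u X etabar = 0.

(* T_u TM is the direct sum of the vertical and the horizontal space. *)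
Definition regular (D : pre_connection) : Prop :=
  forall u, slit u -> forall X : V * V,
    exists! v : V, horizontal D u (X - gam v).

(* The inverse of the restriction of rho to the horizontal bundle. *)
Record horizontal_map (D : pre_connection) (beta : TM -> V -> V * V) : Prop :=
  HorizontalMap {
  hmap_horizontal : forall u v, slit u -> horizontal D u (beta u v);
  hmap_rho : forall u v, slit u -> rho (beta u v) = v;
  hmap_linear : forall u (a : R) v w, slit u ->
    beta u (a *: v + w) = a *: beta u v + beta u w;
  hmap_smooth : forall u Y, slit u ->
    near_pt (fun S => smooth_pivf S Y) u ->
    near_pt (fun S => smooth_vf S (fun w => beta w (Y w))) u
}.

Definition torsion (D : pre_connection) (X Y : TM -> V * V) (u : TM) : V :=
  D u (X u) (rho \o Y) - D u (Y u) (rho \o X) - rho (lie_bracket X Y u).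

Definition curvature (D : pre_connection) (X Y : TM -> V * V) (Z : TM -> V)
    (u : TM) : V :=
  D u (X u) (fun w => D w (Y w) Z) - D u (Y u) (fun w => D w (X w) Z)
  - D u (lie_bracket X Y u) Z.

(* The regular connection that is metric, has vanishing (h)h-torsion, and whose
   (h)hv-torsion T(X, Y) = torsion(gam X, beta Y) satisfies
   g(T(X, Y), Z) = g(T(X, Z), Y). *)
Record cartan_connection (F : TM -> R) (D : pre_connection) : Prop :=
  CartanConnection {
  cartan_conn : connection D;
  cartan_regular : regular D;
  cartan_metric : forall u Y Z, slit u ->
    near_pt (fun S => smooth_pivf S Y) u ->
    near_pt (fun S => smooth_pivf S Z) u ->
    forall X, dfun (fun w : TM => gmet F w (Y w) (Z w)) u X =
      gmet F u (D u X Y) (Z u) + gmet F u (Y u) (D u X Z);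
  cartan_hh : forall beta, horizontal_map D beta ->
    forall u Y Z, slit u ->
    near_pt (fun S => smooth_pivf S Y) u ->
    near_pt (fun S => smooth_pivf S Z) u ->
    torsion D (fun w => beta w (Y w)) (fun w => beta w (Z w)) u = 0;
  cartan_hhv : forall beta, horizontal_map D beta ->
    forall u X Y Z, slit u ->
    near_pt (fun S => smooth_pivf S X) u ->
    near_pt (fun S => smooth_pivf S Y) u ->
    near_pt (fun S => smooth_pivf S Z) u ->
    let T Y' := torsion D (fun w => gam (X w)) (fun w => beta w (Y' w)) u in
    gmet F u (T Y) (Z u) = gmet F u (T Z) (Y u)
}.

(* The regular torsion-free connection for which F is horizontally constant and
   whose (v)hv-torsion, i.e. curvature(beta X, gam Y) etabar, vanishes. *)
Record berwald_connection (F : TM -> R) (D : pre_connection) : Prop :=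
  BerwaldConnection {
  berwald_conn : connection D;
  berwald_regular : regular D;
  berwald_metric : forall u X, slit u -> horizontal D u X -> dfun F u X = 0;
  berwald_torsion : forall u X Y, slit u ->
    near_pt (fun S => smooth_vf S X) u ->
    near_pt (fun S => smooth_vf S Y) u ->
    torsion D X Y u = 0;
  berwald_vhv : forall beta, horizontal_map D beta ->
    forall u X Y, slit u ->
    near_pt (fun S => smooth_pivf S X) u ->
    near_pt (fun S => smooth_pivf S Y) u ->
    curvature D (fun w => beta w (X w)) (fun w => gam (Y w)) etabar u = 0
}.

(* For [nabla] the Cartan connection, [Dc] the Berwald connection and [beta] the
   horizontal map of [nabla]. *)
Record concurrent (nabla Dc : pre_connection) (beta : TM -> V -> V * V)
    (A : TM -> V) : Prop := Concurrent {
  conc_smooth : smooth_pivf slit A;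
  conc_neq0 : forall u, slit u -> A u != 0;
  conc_cartan_h : forall u z, slit u -> nabla u (beta u z) A = - z;
  conc_berwald_h : forall u z, slit u -> Dc u (beta u z) A = - z;
  conc_cartan_v : forall u z, slit u -> nabla u (gam z) A = 0;
  conc_berwald_v : forall u z, slit u -> Dc u (gam z) A = 0
}.

Definition Bform (F : TM -> R) (A : TM -> V) (u : TM) (v : V) : R :=
  gmet F u (A u) v.

Definition Bfun (F : TM -> R) (A : TM -> V) (u : TM) : R :=
  Bform F A u (etabar u).

Definition normA2 (F : TM -> R) (A : TM -> V) (u : TM) : R :=
  gmet F u (A u) (A u).

Definition golden (F : TM -> R) (A : TM -> V) (u : TM) : R :=
  let b := Bfun F A u in b ^+ 2 / F u - F u - b.

Definition calZ (F : TM -> R) (A : TM -> V) (u : TM) : R :=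
  F u ^+ 2 * (1 - 2 * normA2 F A u) + 3 * Bfun F A u ^+ 2.

Definition calE1 (F : TM -> R) (A : TM -> V) (u : TM) : R :=
  let b := Bfun F A u in
  (F u ^+ 2 * (F u ^+ 3 + 3 * F u * b ^+ 2 - 4 * b ^+ 3))
  / ((b ^+ 2 - b * F u - F u ^+ 2) * calZ F A u).

Definition calE2 (F : TM -> R) (A : TM -> V) (u : TM) : R :=
  2 * F u ^+ 4 / calZ F A u.

End Finsler.

Arguments slit {R n} M.

(* Main.v *)
(* Write [b] for the function B(eta) and [a] for A^2.  Berwald torsion freeness
   shows that A does not depend on y, hence db(gamma Z) = g(A, Z).  The Cartan
   connection gives da = -2 d_J b, so dd_J b = 0, and dL(beta Z) = 0 for
   L = F^2; evaluating dd_J L on (beta eta, beta A) and using the (h)h-torsion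
   shows that G - beta eta is vertical and g-orthogonal to A, whence
   db(G) = -F^2, while the spray equation at G gives dL(G) = 0.  These values
   and the relation F (Ft + F + b) = b^2 determine dd_J Ft^2 on
   G - E1 C - E2 gamma A by the product rule, and a field identity shows that
   this vector solves the equation of the canonical spray of Ft, whose solution
   is unique because dd_J Ft^2 has maximal rank. *)
Require Import Defs.
From HB Require Import structures.
From mathcomp Require Import all_boot all_order all_algebra.
From mathcomp Require Import all_classical all_reals all_analysis.
From mathcomp Require Import ring lra.
(* Hides [vector.coord] behind [Defs.coord]. *)
Import Defs.

Set Implicit Arguments.
Unset Strict Implicit.
Unset Printing Implicit Defensive.

Import Order.TTheory GRing.Theory Num.Theory.
Import numFieldNormedType.Exports.

Local Open Scope classical_set_scope.
Local Open Scope ring_scope.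

(** * Differential calculus *)

(** For X = G - E1 C - E2 gamma A, both sides of the spray equation of Ft, evaluated at Y, are
    linear in the four numbers dF(Y), db(Y), dF(JY) and db(JY). The coefficients of dF(Y) and db(Y)
    agree by homogeneity, since dF(C) = F and db(C) = b; E1 and E2 are the values for which the
    coefficients of dF(JY) and db(JY) agree. The factor b^2 - b F - F^2 in E1 is F Ft. The
    horizontal geometry enters this computation through the number db(G) and through dd_J b = 0. The
    former rests on dd_J L (beta eta, beta A) = 0, which is computed in coordinates: the derivative
    of the components of A along beta eta is read off the (h)h-torsion, and Euler's relation for L
    does the rest. Euler's relation also gives regularity: b = 1/2 dL(gamma A), and A^2 = db(gamma
    A) once A is constant on fibres, are first derivatives in a direction that varies with the
    point. The preferred chart varies with the point too, so every formula that is to be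
    differentiated again is first established throughout one fixed chart. *)

Section Differentiability.
Context {R : realType}.
Implicit Types U V W : normedModType R.

(** The differential of [f] also serves for [g], because the remainder estimate only involves points
    near [x]. *)
Lemma near_eq_differentiable U W (f g : U -> W) (x : U) :
  (\near x, f x = g x) -> differentiable f x -> differentiable g x.
Proof.
move=> fg df.
have fgx : f x = g x := nbhs_singleton fg.
have H : g \o shift x = cst (g x) + 'd f x +o_ 0 id.
  apply: eqaddoE; apply/eqaddoP => e e0.
  have /eqaddoP/(_ e e0) hf := diff_locally df.
  have fg' : \forall h \near (0 : U), f (h + x) = g (h + x).
    rewrite (near_shift x); near=> h.
    by rewrite /= sub0r subrK; near: h.
  apply: filterS2 fg' hf => h fgh.
  by rewrite !fctE /= fgh fgx.
have cdf : continuous ('d f x) by exact: diff_continuous.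
by apply/diff_locallyP; rewrite (diff_unique cdf H).
Unshelve. all: by end_near. Qed.

Lemma open_near U (S : set U) (P : U -> Prop) x :
  open S -> S x -> (forall y, S y -> P y) -> \near x, P x.
Proof. by move=> oS Sx SP; apply: filterS SP _; exact: open_nbhs_nbhs. Qed.

Lemma eq_on_differentiable U W (S : set U) (f g : U -> W) x :
  open S -> (forall y, S y -> f y = g y) -> S x ->
  differentiable f x -> differentiable g x.
Proof. by move=> oS fg Sx; apply/near_eq_differentiable/(open_near oS Sx). Qed.

Lemma eq_on_derive U W (S : set U) (f g : U -> W) x v :
  open S -> (forall y, S y -> f y = g y) -> S x -> 'D_v f x = 'D_v g x.
Proof. by move=> oS fg Sx; apply/near_eq_derive/(open_near oS Sx). Qed.

Lemma derive_comp U V W (f : U -> V) (g : V -> W) x v :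
  differentiable f x -> differentiable g (f x) ->
  'D_v (g \o f) x = 'D_('D_v f x) g (f x).
Proof.
move=> df dg.
rewrite (deriveE _ (differentiable_comp df dg)) (deriveE _ df) (deriveE _ dg).
by rewrite (diff_comp df dg).
Qed.

Lemma deriveDv U W (f : U -> W) x v w : differentiable f x ->
  'D_(v + w) f x = 'D_v f x + 'D_w f x.
Proof. by move=> df; rewrite !(deriveE _ df) linearD. Qed.

Lemma deriveZv U W (f : U -> W) x a v : differentiable f x ->
  'D_(a *: v) f x = a *: 'D_v f x.
Proof. by move=> df; rewrite !(deriveE _ df) linearZ. Qed.

Lemma differentiable_lin U W (f : {linear U -> W}) x :
  continuous f -> differentiable f x.
Proof. by move=> cf; apply: linear_differentiable. Qed.

Lemma derive_lin U W (f : {linear U -> W}) x v :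
  continuous f -> 'D_v f x = f v.
Proof. move=> cf; rewrite (deriveE _ (differentiable_lin x cf)) (diff_lin x cf).
by []. Qed.

Lemma differentiable_id U (x : U) : differentiable id x.
Proof. by have [] := is_diff_id x. Qed.

Lemma continuous_fst U V : continuous (fst : U * V -> U).
Proof. by move=> x; exact: cvg_fst. Qed.

Lemma continuous_snd U V : continuous (snd : U * V -> V).
Proof. by move=> x; exact: cvg_snd. Qed.

Lemma fst_is_linear U V : linear (fst : U * V -> U). Proof. by []. Qed.
Lemma snd_is_linear U V : linear (snd : U * V -> V). Proof. by []. Qed.

Lemma differentiable_fst U V (x : U * V) : differentiable fst x.
Proof.
pose F : {linear (U * V)%type -> U} := HB.pack (fst : U * V -> U)
  (GRing.isLinear.Build _ _ _ _ _ (@fst_is_linear U V)).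
exact: (@differentiable_lin _ _ F x (@continuous_fst U V)).
Qed.

Lemma differentiable_snd U V (x : U * V) : differentiable snd x.
Proof.
pose F : {linear (U * V)%type -> V} := HB.pack (snd : U * V -> V)
  (GRing.isLinear.Build _ _ _ _ _ (@snd_is_linear U V)).
exact: (@differentiable_lin _ _ F x (@continuous_snd U V)).
Qed.

Lemma derive_fst U V (x v : U * V) : 'D_v fst x = v.1.
Proof.
pose F : {linear (U * V)%type -> U} := HB.pack (fst : U * V -> U)
  (GRing.isLinear.Build _ _ _ _ _ (@fst_is_linear U V)).
exact: (@derive_lin _ _ F x v (@continuous_fst U V)).
Qed.

Lemma derive_snd U V (x v : U * V) : 'D_v snd x = v.2.
Proof.
pose F : {linear (U * V)%type -> V} := HB.pack (snd : U * V -> V)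
  (GRing.isLinear.Build _ _ _ _ _ (@snd_is_linear U V)).
exact: (@derive_lin _ _ F x v (@continuous_snd U V)).
Qed.

Lemma derive_fst_comp U V W (f : U -> V * W) x v :
  differentiable f x -> 'D_v (fun y => (f y).1) x = ('D_v f x).1.
Proof.
move=> df; rewrite (derive_comp _ df (differentiable_fst _)).
exact: derive_fst.
Qed.

Lemma is_derive_line U W (f : U -> W) (x v : U) (t : R) :
  differentiable f (x + t *: v) ->
  is_derive t 1 (fun s : R => f (x + s *: v)) ('D_v f (x + t *: v)).
Proof.
move=> df.
have dl : is_diff t (fun s : R => x + s *: v) (fun s => s *: v).
  have -> : (fun s : R => x + s *: v) = cst x + (fun s : R => s *: v) by [].
  apply: (is_diff_eq (is_diffD (is_diff_cst x t) (is_diff_scalel t v))).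
  exact: add0r.
have dl' : differentiable (fun s : R => x + s *: v) t by exact: ex_diff.
have dc := differentiable_comp dl' df.
split; first exact: diff_derivable.
rewrite -[X in 'D_1 X t]/(f \o (fun s : R => x + s *: v)).
by rewrite (derive_comp _ dl' df) (deriveE _ dl') diff_val scale1r.
Qed.

Lemma mvt_line U (f : U -> R) (x v : U) (s : R) : 0 < s ->
  (forall t, 0 <= t <= s -> differentiable f (x + t *: v)) ->
  exists2 t, 0 <= t <= s & f (x + s *: v) - f x = s * 'D_v f (x + t *: v).
Proof.
move=> s0 df.
have itv t : t \in `]0, s[%R -> 0 <= t <= s.
  by rewrite in_itv /= => /andP[? ?]; rewrite !ltW.
pose g t := f (x + t *: v).
have [||t /itv t01] := @MVT R g (fun t => 'D_v f (x + t *: v)) 0 s s0.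
- by move=> t /itv t0s; apply: is_derive_line; exact: df.
- apply: derivable_within_continuous => t; rewrite in_itv /= => t0s.
  by have [] := is_derive_line (df t t0s).
by rewrite /g scale0r addr0 subr0 mulrC => e; exists t.
Qed.

End Differentiability.

(** * Symmetry of mixed second derivatives *)

Section Schwarz.
Context {R : realType} {U : normedModType R}.
Implicit Types (f : U -> R) (S : set U) (x u v : U).

(** The mean value theorem is used twice: along [u] for y |-> f (y + s v) - f y, then along [v] for
    ['D_u f]. *)
Lemma second_difference f S x u v (s : R) : 0 < s ->
  (forall y, S y -> differentiable f y) ->
  (forall y, S y -> differentiable ('D_u f) y) ->
  (forall a b, 0 <= a <= s -> 0 <= b <= s -> S (x + a *: u + b *: v)) ->
  exists a b, [/\ 0 <= a <= s, 0 <= b <= s &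
    f (x + s *: u + s *: v) - f (x + s *: u) - (f (x + s *: v) - f x) =
      s ^+ 2 * 'D_v ('D_u f) (x + a *: u + b *: v)].
Proof.
move=> s0 df ddf Sx.
have ss : 0 <= s <= s by rewrite lexx ltW.
have zs : 0 <= (0 : R) <= s by rewrite lexx ltW.
pose g y := f (y + s *: v) - f y.
have dshift y : S (y + s *: v) ->
    differentiable (fun y => f (y + s *: v)) y.
  move=> Sy; apply: (@differentiable_comp _ _ _ _ (fun y => y + s *: v) f).
    by apply: differentiableD; [exact: differentiable_id|
                                exact: differentiable_cst].
  exact: df.
have Dshift y : S (y + s *: v) ->
    'D_u (fun y => f (y + s *: v)) y = 'D_u f (y + s *: v).
  move=> Sy.
  have dt : differentiable (fun y => y + s *: v) y.
    by apply: differentiableD; [exact: differentiable_id|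
                                exact: differentiable_cst].
  rewrite (@derive_comp _ _ _ _ (fun y => y + s *: v) f _ _ dt (df _ Sy)).
  congr ('D__ f _).
  rewrite deriveD; last exact: derivable_cst.
    by rewrite derive_id derive_cst addr0.
  exact: derivable_id.
have Sa a : 0 <= a <= s -> S (x + a *: u).
  by move=> a0; have := Sx a 0 a0 zs; rewrite scale0r addr0.
have dg a : 0 <= a <= s -> differentiable g (x + a *: u).
  move=> a0; apply: differentiableB; first by apply: dshift; exact: Sx.
  by apply: df; exact: Sa.
have [a a0 ga] := mvt_line s0 dg.
have [b b0 gb] : exists2 b, 0 <= b <= s &
    'D_u f (x + a *: u + s *: v) - 'D_u f (x + a *: u) =
      s * 'D_v ('D_u f) (x + a *: u + b *: v).
  apply: (@mvt_line _ _ ('D_u f) _ v s s0) => t t0; apply: ddf; exact: Sx.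
exists a, b; split=> //.
transitivity (g (x + s *: u) - g x); first by rewrite /g.
rewrite ga expr2 -mulrA -gb; congr (s * _).
have Sab : S (x + a *: u + s *: v) by exact: Sx.
have -> : g = (fun y => f (y + s *: v)) - f by [].
rewrite deriveB; first by rewrite (Dshift _ Sab).
  by apply: diff_derivable; exact: dshift.
by apply: diff_derivable; apply: df; exact: Sa.
Qed.

Lemma near_rectangle x u v (P : U -> Prop) : (\near x, P x) ->
  exists2 s : R, 0 < s & forall a b, 0 <= a <= s -> 0 <= b <= s ->
    P (x + a *: u + b *: v).
Proof.
move=> /nbhs_normP[e /= e0 eP].
(* The displacement is at most e / 2 / k * (|u| + |v|) <= e / 2; the summand 1 keeps [k] positive
   when [u] and [v] vanish. *)
pose k := `|u| + `|v| + 1.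
have k0 : 0 < k by rewrite ltr_wpDl // addr_ge0.
exists (e / 2 / k); first by rewrite !divr_gt0.
move=> a b /andP[a0 ae] /andP[b0 be]; apply: eP => /=.
rewrite -addrA opprD addNKr normrN.
apply: (le_lt_trans (ler_normD _ _)); rewrite !normrZ !ger0_norm //.
have k2 : e / 2 / k * k = e / 2 by rewrite divfK // gt_eqF.
have ek0 : 0 <= e / 2 / k by rewrite !divr_ge0 // ltW.
apply: (@le_lt_trans _ _ (e / 2)); last by rewrite ltr_pdivrMr // ltr_pMr // ltr1n.
rewrite -k2 /k !mulrDr mulr1 -[leLHS]addr0.
by apply: lerD => //; apply: lerD; rewrite ler_wpM2r.
Qed.

(** The second difference of [f] over the parallelogram with sides r u and r v is symmetric in [u]
    and [v]. Divided by r^2, it is a value of each mixed derivative at some point of the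
    parallelogram, and continuity at [x] compares both values with those at [x]. *)
Lemma schwarz f S x u v : open S -> S x ->
  (forall y, S y -> differentiable f y) ->
  (forall y, S y -> differentiable ('D_u f) y) ->
  (forall y, S y -> differentiable ('D_v f) y) ->
  {for x, continuous ('D_v ('D_u f))} -> {for x, continuous ('D_u ('D_v f))} ->
  'D_u ('D_v f) x = 'D_v ('D_u f) x.
Proof.
move=> oS Sx df duf dvf cvu cuv.
apply/eqP; rewrite -subr_eq0 -normr_le0; apply/ler_addgt0Pr => e e0.
rewrite add0r.
have e2 : 0 < e / 2 by rewrite divr_gt0.
have nS : \near x, S x by exact: open_nbhs_nbhs.
have /cvgrPdist_lt/(_ _ e2) nvu := cvu.
have /cvgrPdist_lt/(_ _ e2) nuv := cuv.
have [s s0 sP] := near_rectangle u v (filterI nS (filterI nvu nuv)).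
have [s' s'0 s'P] := near_rectangle v u (filterI nS (filterI nvu nuv)).
pose r := Num.min s s'.
have r0 : 0 < r by rewrite lt_min s0 s'0.
have rs a : 0 <= a <= r -> 0 <= a <= s.
  by move=> /andP[-> h]; rewrite (le_trans h) // ge_min lexx.
have rs' a : 0 <= a <= r -> 0 <= a <= s'.
  by move=> /andP[-> h]; rewrite (le_trans h) // ge_min lexx orbT.
have [|a [b [/rs ar /rs br Euv]]] := second_difference r0 df duf (x := x) (v := v).
  by move=> a b /rs a0 /rs b0; have [] := sP _ _ a0 b0.
have [|a' [b' [/rs' a'r /rs' b'r Evu]]] :=
    second_difference r0 df dvf (x := x) (v := u).
  by move=> a' b' /rs' a0 /rs' b0; have [] := s'P _ _ a0 b0.
have [_ [h1 _]] := sP _ _ ar br.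
have [_ [_ h2]] := s'P _ _ a'r b'r.
have E : 'D_v ('D_u f) (x + a *: u + b *: v) = 'D_u ('D_v f) (x + a' *: v + b' *: u).
  apply: (mulfI (_ : r ^+ 2 != 0)); first by rewrite expf_neq0 // gt_eqF.
  apply: etrans (esym Euv) (etrans _ Evu); rewrite [x + r *: v + r *: u]addrAC.
  move: (f (x + r *: u + r *: v)) (f (x + r *: u)) (f (x + r *: v)) (f x) => p p1 p2 p3.
  by rewrite !opprD !opprK !addrA [p - p1 - p2]addrAC.
move: h1 h2 => /=; rewrite E; set y := 'D_u _ _ => h1 h2.
rewrite [e]splitr; apply: ltW; apply: (le_lt_trans _ (ltrD h2 h1)).
by rewrite [X in _ <= _ + X]distrC; exact: ler_distD.
Qed.

End Schwarz.

(** * Closure properties of smooth functions *)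

Section SmoothOn.
Context {R : realType}.
Implicit Types U V W : normedModType R.

Lemma iter_derive_rcons U W (vs : seq U) v (f : U -> W) :
  iter_derive (rcons vs v) f = iter_derive vs ('D_v f).
Proof. by elim: vs => //= w vs ->. Qed.

(** A truncation of [smooth_on] that allows induction on the order: the product and chain rules
    express a derivative of order k + 1 through functions already treated at order k. *)
Definition Ck U W (k : nat) (S : set U) (f : U -> W) : Prop :=
  forall vs x, (size vs <= k)%N -> S x -> differentiable (iter_derive vs f) x.

Lemma smooth_onP U W (S : set U) (f : U -> W) :
  smooth_on S f <-> forall k, Ck k S f.
Proof.
split=> [sf k vs x _ Sx|kf vs x Sx]; first exact: sf.
exact: (kf (size vs)).
Qed.

(** The derivative split off is the innermost one, the last entry of the list, so that the induction
    hypothesis applies to ['D_v f]. *)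
Lemma CkS U W k (S : set U) (f : U -> W) :
  Ck k.+1 S f <->
  (forall x, S x -> differentiable f x) /\ forall v, Ck k S ('D_v f).
Proof.
split=> [kf|[df kf] vs x].
  split=> [x Sx|v vs x vsk Sx]; first exact: (kf [::]).
  by rewrite -iter_derive_rcons; apply: kf; rewrite ?size_rcons.
case/lastP: vs => [_ Sx|vs v]; first exact: df.
rewrite size_rcons ltnS iter_derive_rcons => vsk Sx; exact: kf.
Qed.

Lemma Ck_differentiable U W k (S : set U) (f : U -> W) x :
  Ck k S f -> S x -> differentiable f x.
Proof. by move=> kf Sx; exact: (kf [::]). Qed.

Lemma smooth_on_differentiable U W (S : set U) (f : U -> W) x :
  smooth_on S f -> S x -> differentiable f x.
Proof. by move=> sf Sx; exact: (sf [::]). Qed.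

Lemma smooth_on_derive U W (S : set U) (f : U -> W) v :
  smooth_on S f -> smooth_on S ('D_v f).
Proof. by move=> sf vs x Sx; rewrite -iter_derive_rcons; exact: sf. Qed.

Lemma smooth_on_sub U W (S S' : set U) (f : U -> W) :
  S' `<=` S -> smooth_on S f -> smooth_on S' f.
Proof. by move=> SS sf vs x /SS; exact: sf. Qed.

Lemma Ck0 U W (S : set U) (f : U -> W) :
  (forall x, S x -> differentiable f x) -> Ck 0 S f.
Proof. by move=> df vs x; rewrite leqn0 => /nilP ->; exact: df. Qed.

Lemma Ck_ext U W k (S : set U) (f g : U -> W) : open S ->
  (forall x, S x -> f x = g x) -> Ck k S f -> Ck k S g.
Proof.
move=> oS; elim: k f g => [|k IH] f g fg.
  move=> kf; apply: Ck0 => x Sx.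
  exact: eq_on_differentiable oS fg Sx (Ck_differentiable kf Sx).
move=> /CkS[df kf]; apply/CkS; split=> [x Sx|v].
  exact: eq_on_differentiable oS fg Sx (df _ Sx).
apply: IH (kf v) => x Sx; exact: eq_on_derive oS fg Sx.
Qed.

Lemma smooth_on_ext U W (S : set U) (f g : U -> W) : open S ->
  (forall x, S x -> f x = g x) -> smooth_on S f -> smooth_on S g.
Proof.
by move=> oS fg /smooth_onP kf; apply/smooth_onP => k; exact: Ck_ext oS fg (kf k).
Qed.

Lemma smooth_on_schwarz U (S : set U) (f : U -> R) x u v : open S ->
  smooth_on S f -> S x -> 'D_u ('D_v f) x = 'D_v ('D_u f) x.
Proof.
move=> oS sf Sx.
have dS g y : smooth_on S g -> S y -> differentiable g y.
  by move=> sg; exact: smooth_on_differentiable.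
have s1 w : smooth_on S ('D_w f) by exact: smooth_on_derive.
have s2 w z : smooth_on S ('D_w ('D_z f)) by exact: smooth_on_derive.
apply: (schwarz oS Sx).
- by move=> y; exact: dS.
- by move=> y; exact: dS.
- by move=> y; exact: dS.
- exact/differentiable_continuous/dS.
- exact/differentiable_continuous/dS.
Qed.

Lemma Ck_cst U W k (S : set U) (w : W) : Ck k S (cst w : U -> W).
Proof.
elim: k w => [|k IH] w.
  by apply: Ck0 => x _; exact: differentiable_cst.
apply/CkS; split=> [x _|v]; first exact: differentiable_cst.
have -> : 'D_v (cst w : U -> W) = cst 0 by apply/funext => x; exact: derive_cst.
exact: IH.
Qed.

Lemma Ck_add U W k (S : set U) (f g : U -> W) : open S ->
  Ck k S f -> Ck k S g -> Ck k S (fun x => f x + g x).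
Proof.
move=> oS; elim: k f g => [|k IH] f g.
  move=> kf kg; apply: Ck0 => x Sx.
  exact: differentiableD (Ck_differentiable kf Sx) (Ck_differentiable kg Sx).
move=> /CkS[df kf] /CkS[dg kg]; apply/CkS; split=> [x Sx|v].
  exact: differentiableD (df _ Sx) (dg _ Sx).
apply: Ck_ext oS _ (IH _ _ (kf v) (kg v)) => x Sx.
exact: esym (deriveD (diff_derivable (df _ Sx)) (diff_derivable (dg _ Sx))).
Qed.

Lemma Ck_sum U W k (S : set U) m (f : 'I_m -> U -> W) : open S ->
  (forall i, Ck k S (f i)) -> Ck k S (fun x => \sum_i f i x).
Proof.
move=> oS kf; elim: m f kf => [|m IH] f kf.
  by under eq_fun do rewrite big_ord0; exact: Ck_cst.
under eq_fun do rewrite big_ord_recr /=.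
by apply: Ck_add => //; exact: IH.
Qed.

Lemma Ck_mul U k (S : set U) (f g : U -> R) : open S ->
  Ck k S f -> Ck k S g -> Ck k S (fun x => f x * g x).
Proof.
move=> oS; elim: k f g => [|k IH] f g.
  move=> kf kg; apply: Ck0 => x Sx.
  exact: differentiableM (Ck_differentiable kf Sx) (Ck_differentiable kg Sx).
move=> kf1 kg1; have /CkS[df kf] := kf1; have /CkS[dg kg] := kg1.
apply/CkS; split=> [x Sx|v]; first exact: differentiableM (df _ Sx) (dg _ Sx).
(* The product rule leaves one factor underived, so its order has to be lowered by hand. *)
have lower (h : U -> R) : Ck k.+1 S h -> Ck k S h.
  by move=> kh vs x vsk; apply: kh; exact: leqW.
have k1 := IH _ _ (lower f kf1) (kg v).
have k2 := IH _ _ (lower g kg1) (kf v).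
apply: Ck_ext oS _ (Ck_add oS k1 k2) => x Sx.
exact: esym (deriveM (diff_derivable (df _ Sx)) (diff_derivable (dg _ Sx))).
Qed.

Lemma smooth_on_add U W (S : set U) (f g : U -> W) : open S ->
  smooth_on S f -> smooth_on S g -> smooth_on S (fun x => f x + g x).
Proof.
move=> oS /smooth_onP kf /smooth_onP kg; apply/smooth_onP => k; exact: Ck_add.
Qed.

Lemma smooth_on_mul U (S : set U) (f g : U -> R) : open S ->
  smooth_on S f -> smooth_on S g -> smooth_on S (fun x => f x * g x).
Proof.
move=> oS /smooth_onP kf /smooth_onP kg; apply/smooth_onP => k; exact: Ck_mul.
Qed.

Lemma smooth_on_sum U W (S : set U) m (f : 'I_m -> U -> W) : open S ->
  (forall i, smooth_on S (f i)) -> smooth_on S (fun x => \sum_i f i x).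
Proof.
move=> oS sf; apply/smooth_onP => k; apply: Ck_sum => // i.
by have /smooth_onP := sf i.
Qed.

Lemma smooth_on_cst U W (S : set U) (w : W) : smooth_on S (cst w : U -> W).
Proof. by apply/smooth_onP => k; exact: Ck_cst. Qed.

Lemma smooth_on_lin_comp U V W (S : set U) (L : {linear V -> W}) (f : U -> V) :
  open S -> continuous L -> smooth_on S f -> smooth_on S (L \o f).
Proof.
move=> oS cL /smooth_onP kf; apply/smooth_onP => k.
have dL y : differentiable L y by exact: differentiable_lin.
have {}kf := kf k; elim: k f kf => [|k IH] f.
  move=> kf; apply: Ck0 => x Sx.
  exact: differentiable_comp (Ck_differentiable kf Sx) (dL _).
move=> /CkS[df kf]; apply/CkS; split=> [x Sx|v].
  exact: differentiable_comp (df _ Sx) (dL _).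
apply: Ck_ext oS _ (IH _ (kf v)) => x Sx.
by rewrite (derive_comp _ (df _ Sx) (dL _)) (derive_lin _ _ cL).
Qed.

Lemma smooth_on_lin U W (S : set U) (L : {linear U -> W}) :
  open S -> continuous L -> smooth_on S L.
Proof.
move=> oS cL; have dL y : differentiable L y by exact: differentiable_lin.
apply/smooth_onP => -[|k]; first by apply: Ck0 => x _; exact: dL.
apply/CkS; split=> [x _|v]; first exact: dL.
have -> : 'D_v L = cst (L v) by apply/funext => x; exact: derive_lin.
exact: Ck_cst.
Qed.

Lemma smooth_on_fst U V (S : set (U * V)) : open S -> smooth_on S fst.
Proof.
move=> oS.
pose F : {linear (U * V)%type -> U} := HB.pack (fst : U * V -> U)
  (GRing.isLinear.Build _ _ _ _ _ (@fst_is_linear R U V)).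
exact: (@smooth_on_lin _ _ S F oS (@continuous_fst R U V)).
Qed.

Lemma smooth_on_snd U V (S : set (U * V)) : open S -> smooth_on S snd.
Proof.
move=> oS.
pose F : {linear (U * V)%type -> V} := HB.pack (snd : U * V -> V)
  (GRing.isLinear.Build _ _ _ _ _ (@snd_is_linear R U V)).
exact: (@smooth_on_lin _ _ S F oS (@continuous_snd R U V)).
Qed.

Lemma pair0_is_linear U V : linear ((fun v => (0, v)) : U -> V * U).
Proof. by move=> a u v; apply: injective_projections; rewrite /= ?scaler0 ?addr0. Qed.

Lemma fst0_is_linear U V : linear ((fun v => (v, 0)) : U -> U * V).
Proof. by move=> a u v; apply: injective_projections; rewrite /= ?scaler0 ?addr0. Qed.

Lemma continuous_pair0 U V : continuous ((fun v => (0, v)) : U -> V * U).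
Proof. by move=> x; apply: cvg_pair; [exact: cvg_cst|exact: cvg_id]. Qed.

Lemma continuous_fst0 U V : continuous ((fun v => (v, 0)) : U -> U * V).
Proof. by move=> x; apply: cvg_pair; [exact: cvg_id|exact: cvg_cst]. Qed.

Lemma smooth_on_pair U V W (S : set U) (f : U -> V) (g : U -> W) : open S ->
  smooth_on S f -> smooth_on S g -> smooth_on S (fun x => (f x, g x)).
Proof.
move=> oS sf sg.
pose F : {linear V -> (V * W)%type} := HB.pack (fun v : V => (v, 0 : W))
  (GRing.isLinear.Build _ _ _ _ _ (@fst0_is_linear V W)).
pose G : {linear W -> (V * W)%type} := HB.pack (fun w : W => (0 : V, w))
  (GRing.isLinear.Build _ _ _ _ _ (@pair0_is_linear W V)).
have sF := @smooth_on_lin_comp _ _ _ S F f oS (@continuous_fst0 V W) sf.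
have sG := @smooth_on_lin_comp _ _ _ S G g oS (@continuous_pair0 W V) sg.
apply: smooth_on_ext oS _ (smooth_on_add oS sF sG) => x _.
by congr pair; rewrite /= ?addr0 ?add0r.
Qed.

End SmoothOn.

(** * Coordinates, varying directions and composition *)

Section FiniteDimension.
Context {R : realType} {n : nat}.
Implicit Types U W : normedModType R.
Local Notation V := 'rV[R]_n.

Lemma coord_is_linear i : linear ((fun v : V => v 0 i) : V -> R^o).
Proof. by move=> a u v; rewrite !mxE. Qed.

Lemma continuous_coord i : continuous ((fun v : V => v 0 i) : V -> R^o).
Proof. by move=> x; apply: differentiable_continuous; exact: differentiable_coord. Qed.

Lemma smooth_on_coord U (S : set U) (f : U -> V) i : open S ->
  smooth_on S f -> smooth_on S (fun x => f x 0 i : R).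
Proof.
move=> oS sf.
pose F : {linear V -> R^o} := HB.pack ((fun v : V => v 0 i) : V -> R^o)
  (GRing.isLinear.Build _ _ _ _ _ (@coord_is_linear i)).
exact: (@smooth_on_lin_comp _ _ _ _ S F f oS (@continuous_coord i) sf).
Qed.

Lemma derive_coord U (f : U -> V) x v i : differentiable f x ->
  'D_v (fun y => f y 0 i) x = 'D_v f x 0 i.
Proof.
move=> df.
pose F : {linear V -> R^o} := HB.pack ((fun v : V => v 0 i) : V -> R^o)
  (GRing.isLinear.Build _ _ _ _ _ (@coord_is_linear i)).
rewrite -[LHS]/('D_v (F \o f) x).
rewrite (derive_comp _ df (differentiable_lin _ (@continuous_coord i : continuous F))).
exact: (derive_lin _ _ (@continuous_coord i : continuous F)).
Qed.

Lemma derive_basis U W (E : {linear V -> U}) (f : U -> W) x v :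
  differentiable f x ->
  'D_(E v) f x = \sum_i v 0 i *: 'D_(E (delta_mx 0 i)) f x.
Proof.
move=> df; rewrite [in LHS](row_sum_delta v) linear_sum (deriveE _ df) linear_sum.
by apply: eq_bigr => i _; rewrite !linearZ (deriveE _ df).
Qed.

(* [E (h x)] is a direction varying with the point, such as [(0, h q)]. *)
Lemma smooth_on_derive_dir U (E : {linear V -> U}) (S : set U) (f : U -> R)
    (h : U -> V) : open S -> smooth_on S f -> smooth_on S h ->
  smooth_on S (fun x => 'D_(E (h x)) f x).
Proof.
move=> oS sf sh.
have sE : smooth_on S (fun x => \sum_i h x 0 i * 'D_(E (delta_mx 0 i)) f x).
  apply: smooth_on_sum => // i; apply: smooth_on_mul => //.
    exact: smooth_on_coord.
  exact: smooth_on_derive.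
apply: smooth_on_ext oS _ sE => x Sx.
by rewrite derive_basis //; exact: smooth_on_differentiable sf Sx.
Qed.

(** Expanding the direction in the basis of V gives a finite sum of products; Leibniz separates the
    derivative with the direction frozen at [x] from the term in which only the direction moves. *)
Lemma derive_derive_dir U (E : {linear V -> U}) (S : set U) (f : U -> R)
    (h : U -> V) x w : open S -> smooth_on S f -> S x -> differentiable h x ->
  'D_w (fun y => 'D_(E (h y)) f y) x =
    'D_w ('D_(E (h x)) f) x + 'D_(E ('D_w h x)) f x.
Proof.
move=> oS sf Sx dh.
have df y : S y -> differentiable f y by exact: smooth_on_differentiable.
have ddf i : derivable ('D_(E (delta_mx 0 i)) f) x w.
  apply: diff_derivable; apply: smooth_on_differentiable Sx.
  exact: smooth_on_derive.
have dhi i : derivable (fun y => h y 0 i : R) x w.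
  apply: diff_derivable.
  exact: (differentiable_comp dh (differentiable_coord (h x) 0 i)).
have Eh y : S y -> 'D_(E (h y)) f y =
    (\sum_i (fun y => h y 0 i * 'D_(E (delta_mx 0 i)) f y)) y.
  by move=> Sy; rewrite derive_basis ?fct_sumE //; exact: df.
have Ec y : S y -> 'D_(E (h x)) f y =
    (\sum_i (fun y => h x 0 i *: 'D_(E (delta_mx 0 i)) f y)) y.
  by move=> Sy; rewrite derive_basis ?fct_sumE //; exact: df.
rewrite (eq_on_derive _ oS Eh Sx) (eq_on_derive _ oS Ec Sx).
rewrite derive_basis; last exact: df.
rewrite !derive_sum; last first.
- by move=> i; exact: derivableM.
- by move=> i; exact: derivableZ.
rewrite -big_split; apply: eq_bigr => i _ /=.
rewrite (deriveM (dhi i) (ddf i)) (deriveZ _ (ddf i)) derive_coord //.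
by congr (_ + _); exact: mulrC.
Qed.

(** The chain rule in coordinates writes a derivative of [f \o g] as a finite sum of products of
    components of ['D_v g] with partial derivatives of [f] composed with [g]; hence [f] varies in
    the induction while [g] stays fixed. *)
Lemma Ck_comp U k (S : set U) (T : set V) (g : U -> V) (f : V -> R) :
  open S -> (forall x, S x -> T (g x)) -> smooth_on S g -> smooth_on T f ->
  Ck k S (f \o g).
Proof.
move=> oS gST sg; have dg x : S x -> differentiable g x.
  exact: smooth_on_differentiable.
elim: k f => [|k IH] f sf.
  apply: Ck0 => x Sx; apply: differentiable_comp; first exact: dg.
  exact: smooth_on_differentiable sf (gST _ Sx).
have df y : T y -> differentiable f y by exact: smooth_on_differentiable.
apply/CkS; split=> [x Sx|v].
  exact: differentiable_comp (dg _ Sx) (df _ (gST _ Sx)).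
have kE : Ck k S (fun x => \sum_i 'D_v g x 0 i * ('D_(delta_mx 0 i) f \o g) x).
  apply: Ck_sum => // i; apply: Ck_mul => //.
    have /smooth_onP := smooth_on_coord i oS (smooth_on_derive v sg); exact.
  by apply: IH; exact: smooth_on_derive.
apply: Ck_ext oS _ kE => x Sx.
rewrite (derive_comp _ (dg _ Sx) (df _ (gST _ Sx))).
by rewrite (derive_basis idfun) //; exact/df/gST.
Qed.

Lemma smooth_on_rV U (S : set U) (f : U -> V) : open S ->
  (forall i, smooth_on S (fun x => f x 0 i : R)) -> smooth_on S f.
Proof.
move=> oS sf.
have cZ (w : V) : continuous ( *:%R^~ w : R^o -> V).
  by move=> x; exact: scalel_continuous.
have lZ (w : V) : linear ( *:%R^~ w : R^o -> V).
  by move=> a u v; rewrite scalerDl scalerA.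
pose Z (w : V) : {linear R^o -> V} := HB.pack ( *:%R^~ w : R^o -> V)
  (GRing.isLinear.Build _ _ _ _ _ (lZ w)).
have sE : smooth_on S (fun x => \sum_i (Z (delta_mx 0 i) \o (fun x => f x 0 i : R)) x).
  apply: smooth_on_sum => // i; apply: smooth_on_lin_comp => //; exact: cZ.
apply: smooth_on_ext oS _ sE => x _.
by rewrite [RHS]row_sum_delta.
Qed.

Lemma smooth_on_comp U (S : set U) (T : set V) (g : U -> V) (f : V -> V) :
  open S -> open T -> (forall x, S x -> T (g x)) ->
  smooth_on S g -> smooth_on T f -> smooth_on S (f \o g).
Proof.
move=> oS oT gST sg sf; apply: (smooth_on_rV oS) => i; apply/smooth_onP => k.
exact: (@Ck_comp U k S T g (fun v => f v 0 i : R) oS gST sg (smooth_on_coord i oT sf)).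
Qed.

End FiniteDimension.

(** * Charts of a manifold and of its tangent bundle *)

Section Charts.
Context {R : realType}.

(** The difference quotient is constantly [w]. The intended use is a tangent transition map, which
    is affine along fibres. *)
Lemma derive_affine_line (U W : normedModType R) (f : U -> W) x v w :
  (forall h : R, f (h *: v + x) = f x + h *: w) -> 'D_v f x = w.
Proof.
move=> fh; rewrite /derive; apply: cvg_lim => //.
apply: (@cvg_trans _ ((cst w : R -> W) @ 0^')); last exact: cvg_cst.
apply: near_eq_cvg; near=> h.
have h0 : h != 0 by near: h; exact: nbhs_dnbhs_neq.
by rewrite /= fh addrAC subrr add0r scalerA mulVf // scale1r.
Unshelve. all: by end_near. Qed.

(** The local axioms of [smooth_manifold], isolated so that the same chart lemmas serve M and,
    through [smooth_atlas_tangent], also TM. *)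
Record smooth_atlas (V : normedModType R) (N : charted V) : Prop := SmoothAtlas {
  sa_chart_at : forall x : N, atlas (chart_at x) /\ dom (chart_at x) x;
  sa_paramK : forall (c : chart N V) (x : N),
    atlas c -> dom c x -> param c (coord c x) = x;
  sa_overlap : forall c c' : chart N V, atlas c -> atlas c' ->
    open (coord c @` (dom c `&` dom c'));
  sa_transition : forall c c' : chart N V, atlas c -> atlas c' ->
    smooth_on (coord c @` (dom c `&` dom c')) (coord c' \o param c)
}.

Lemma smooth_manifold_atlas (V : normedModType R) (N : charted V) :
  smooth_manifold N -> smooth_atlas N.
Proof. by case. Qed.

Section SmoothAtlas.
Context {V : normedModType R} (N : charted V) (hN : smooth_atlas N).
Implicit Types (c : chart N V) (x : N) (S : set N) (p v : V).

Lemma atlas_at x : atlas (chart_at x). Proof. by have [] := sa_chart_at hN x. Qed.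
Lemma dom_at x : dom (chart_at x) x. Proof. by have [] := sa_chart_at hN x. Qed.

Lemma open_chart_image c : atlas c -> open (coord c @` dom c).
Proof. by move=> ac; have := sa_overlap hN ac ac; rewrite setIid. Qed.

Lemma chart_imageP c S p : atlas c ->
  (coord c @` (S `&` dom c)) p <->
  [/\ (coord c @` dom c) p, dom c (param c p), S (param c p) &
      coord c (param c p) = p].
Proof.
move=> ac; split=> [[x [Sx dx] <-]|[_ d s e]]; last by exists (param c p).
by rewrite (sa_paramK hN ac dx); split => //; exists x.
Qed.

Lemma chart_paramK c p : atlas c -> (coord c @` dom c) p ->
  dom c (param c p) /\ coord c (param c p) = p.
Proof. by move=> ac [x dx <-]; rewrite (sa_paramK hN ac dx). Qed.

Lemma differentiable_transition c c' x : atlas c -> atlas c' -> dom c x ->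
  dom c' x -> differentiable (coord c' \o param c) (coord c x).
Proof.
move=> ac ac' dx dx'.
by apply: smooth_on_differentiable (sa_transition hN ac ac') _; exists x.
Qed.

(** This is the chain rule for [f \o param c] = ([f \o param c']) after the transition map on the
    overlap. The changes of chart below reduce to it. *)
Lemma derive_transition c c' x v (W : normedModType R) (f : N -> W) :
  atlas c -> atlas c' -> dom c x -> dom c' x ->
  differentiable (f \o param c') (coord c' x) ->
  'D_('D_v (coord c' \o param c) (coord c x)) (f \o param c') (coord c' x) =
  'D_v (f \o param c) (coord c x).
Proof.
move=> ac ac' dx dx' df.
have oS := sa_overlap hN ac ac'.
have Sx : (coord c @` (dom c `&` dom c')) (coord c x) by exists x.
have dt := differentiable_transition ac ac' dx dx'.
have ex : (coord c' \o param c) (coord c x) = coord c' x.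
  by rewrite /= (sa_paramK hN ac dx).
have := @derive_comp _ _ _ _ _ _ _ v dt; rewrite ex => /(_ _ _ df) <-.
apply: eq_on_derive oS _ Sx => _ [y [dy dy'] <-] /=.
by rewrite (sa_paramK hN ac dy) (sa_paramK hN ac' dy').
Qed.

Lemma dfunE c x (f : N -> R) v : atlas c -> dom c x ->
  differentiable (f \o param c) (coord c x) ->
  dfun f x v = 'D_(to_chart c x v) (f \o param c) (coord c x).
Proof.
move=> ac dx df.
by rewrite /dfun /to_chart (derive_transition v (atlas_at x) ac (dom_at x) dx).
Qed.

Lemma to_chart_of_chart c c' x v : atlas c -> atlas c' -> dom c x -> dom c' x ->
  to_chart c' x (of_chart c (coord c x) v) =
  'D_v (coord c' \o param c) (coord c x).
Proof.
move=> ac ac' dx dx'; rewrite /to_chart /of_chart (sa_paramK hN ac dx).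
have ax := atlas_at x; have dxx := dom_at x.
exact: derive_transition ac ax dx dxx (differentiable_transition ax ac' dxx dx').
Qed.

Lemma derive_chart_id c x v : atlas c -> dom c x ->
  'D_v (coord c \o param c) (coord c x) = v.
Proof.
move=> ac dx; have ox := open_chart_image ac.
have Sx : (coord c @` dom c) (coord c x) by exists x.
rewrite -[RHS](derive_id (coord c x)); apply: (eq_on_derive _ ox _ Sx) => p Op.
exact: (chart_paramK ac Op).2.
Qed.

Lemma to_chartK c x v : atlas c -> dom c x ->
  to_chart c x (of_chart c (coord c x) v) = v.
Proof. by move=> ac dx; rewrite to_chart_of_chart // derive_chart_id. Qed.

Lemma to_chart_at x v : to_chart (chart_at x) x v = v.
Proof. exact: derive_chart_id (atlas_at x) (dom_at x). Qed.

Lemma of_chartK c x v : atlas c -> dom c x ->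
  of_chart c (coord c x) (to_chart c x v) = v.
Proof.
move=> ac dx; rewrite /to_chart /of_chart (sa_paramK hN ac dx).
have ax := atlas_at x; have dxx := dom_at x.
have dt := differentiable_transition ac ax dx dxx.
by rewrite (derive_transition v ax ac dxx dx dt) derive_chart_id.
Qed.

Lemma to_chartZ c x a v : atlas c -> dom c x ->
  to_chart c x (a *: v) = a *: to_chart c x v.
Proof.
move=> ac dx; apply: deriveZv.
exact: differentiable_transition (atlas_at x) ac (dom_at x) dx.
Qed.

Lemma to_chart0 c x : to_chart c x 0 = 0.
Proof. exact: derive0. Qed.

Lemma to_chart_eq0 c x v : atlas c -> dom c x ->
  (to_chart c x v == 0) = (v == 0).
Proof.
move=> ac dx; apply/eqP/eqP => [v0|->]; last exact: to_chart0.
by rewrite -(of_chartK v ac dx) v0; exact: derive0.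
Qed.

Lemma of_chartZ c x a v : atlas c -> dom c x ->
  of_chart c (coord c x) (a *: v) = a *: of_chart c (coord c x) v.
Proof.
move=> ac dx; rewrite -[LHS](of_chartK _ ac dx) -[RHS](of_chartK _ ac dx).
by rewrite to_chartZ // !to_chartK.
Qed.

Lemma dfunD x (f : N -> R) v w :
  differentiable (f \o param (chart_at x)) (coord (chart_at x) x) ->
  dfun f x (v + w) = dfun f x v + dfun f x w.
Proof. by move=> df; exact: deriveDv. Qed.

End SmoothAtlas.
End Charts.

(** * The induced atlas of the tangent bundle *)

Section TangentAtlas.
Context {R : realType} {n : nat} (M : charted 'rV[R]_n) (hM : smooth_atlas M).
Local Notation V := 'rV[R]_n.
Local Notation TM := (tangent M).
Implicit Types (c : chart M V) (u : TM) (p v w : V) (q X : V * V).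

Lemma tangent_chart_overlapE c c' : atlas c -> atlas c' ->
  coord (tangent_chart c) @` (dom (tangent_chart c) `&` dom (tangent_chart c')) =
  fst @^-1` (coord c @` (dom c `&` dom c')).
Proof.
move=> ac ac'; apply/seteqP; split=> [_ [u [du du'] <-]|q [x [dx dx'] xq]].
  by exists u.1.
exists (x, of_chart c q.1 q.2) => //=.
by rewrite -xq (to_chartK hM _ ac dx) xq; case: q {xq}.
Qed.

(** The tangent map of [f], in coordinates: what a transition map of M induces on TM. *)
Definition tangent_transition (f : V -> V) (q : V * V) : V * V :=
  (f q.1, 'D_(q.2) f q.1).

Lemma tangent_transitionE c c' (q : V * V) : atlas c -> atlas c' ->
  (coord c @` (dom c `&` dom c')) q.1 ->
  coord (tangent_chart c') (param (tangent_chart c) q) =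
  tangent_transition (coord c' \o param c) q.
Proof.
move=> ac ac' [x [dx dx'] xq]; rewrite /tangent_transition /= -xq.
rewrite (sa_paramK hM ac dx); congr pair.
exact: (to_chart_of_chart hM _ ac ac' dx dx').
Qed.

Lemma smooth_tangent_transition (S : set V) (f : V -> V) : open S ->
  smooth_on S f -> smooth_on (fst @^-1` S) (tangent_transition f).
Proof.
move=> oS sf.
have oS' : open (fst @^-1` S : set (V * V)).
  by apply: open_comp => // q _; exact: continuous_fst.
have sf1 : smooth_on (fst @^-1` S : set (V * V)) (f \o fst).
  exact: (smooth_on_comp oS' oS _ (smooth_on_fst oS') sf).
apply: smooth_on_pair => //; apply: (smooth_on_rV oS') => i.
(* Composing [f] with [fst] and embedding directions by v |-> (v, 0) puts the function and its
   direction q.2 on the same space, as [smooth_on_derive_dir] requires. *)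
pose E : {linear V -> (V * V)%type} := HB.pack (fun v : V => (v, 0 : V))
  (GRing.isLinear.Build _ _ _ _ _ (@fst0_is_linear R V V)).
have := smooth_on_derive_dir E oS' (smooth_on_coord i oS' sf1) (smooth_on_snd oS').
apply: smooth_on_ext => // q Sq.
have df : differentiable f q.1 := smooth_on_differentiable sf Sq.
have d1 := differentiable_fst q.
rewrite (derive_coord _ _ (differentiable_comp d1 df)) (derive_comp _ d1 df).
by rewrite derive_fst.
Qed.

Lemma smooth_atlas_tangent : smooth_atlas TM.
Proof.
split.
- move=> u; have [a d] := sa_chart_at hM u.1; split=> //.
  by exists (chart_at u.1).
- move=> _ u [c ac <-] /= du.
  rewrite (sa_paramK hM ac du) (of_chartK hM _ ac du).
  by case: u {du}.
- move=> _ _ [c ac <-] [c' ac' <-]; rewrite tangent_chart_overlapE //.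
  apply: open_comp => [q _|]; first exact: continuous_fst.
  by have := sa_overlap hM ac ac'.
- move=> _ _ [c ac <-] [c' ac' <-]; rewrite tangent_chart_overlapE //.
  have oS := sa_overlap hM ac ac'.
  have oS' : open (fst @^-1` (coord c @` (dom c `&` dom c')) : set (V * V)).
    by apply: open_comp => // q _; exact: continuous_fst.
  apply: smooth_on_ext oS' _ (smooth_tangent_transition oS (sa_transition hM ac ac')).
  by move=> q Sq; rewrite /comp tangent_transitionE.
Qed.

Lemma atlas_tangent c : atlas c -> atlas (c := TM) (tangent_chart c).
Proof. by move=> ac; exists c. Qed.

Lemma to_tangent_chartE c u (X : V * V) : atlas c -> dom c u.1 ->
  to_chart (N := TM) (tangent_chart c) u X =
  'D_X (tangent_transition (coord c \o param (chart_at u.1)))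
    (coord (chart_at u) u).
Proof.
move=> ac du.
have ax := atlas_at hM u.1; have dx := dom_at hM u.1.
have oS := sa_overlap hM ax ac.
have oS' : open (fst @^-1` (coord (chart_at u.1) @`
    (dom (chart_at u.1) `&` dom c)) : set (V * V)).
  by apply: open_comp => // q _; exact: continuous_fst.
have Su : (fst @^-1` (coord (chart_at u.1) @` (dom (chart_at u.1) `&` dom c)))
    (coord (chart_at u) u) by exists u.1.
apply: eq_on_derive oS' _ Su => q Sq.
exact: tangent_transitionE.
Qed.

Lemma to_tangent_chart_fst c u (X : V * V) : atlas c -> dom c u.1 ->
  (to_chart (N := TM) (tangent_chart c) u X).1 = to_chart c u.1 X.1.
Proof.
move=> ac du; rewrite to_tangent_chartE //.
have ax := atlas_at hM u.1; have dx := dom_at hM u.1.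
have oS := sa_overlap hM ax ac.
have sT := smooth_tangent_transition oS (sa_transition hM ax ac).
have dT : differentiable (tangent_transition (coord c \o param (chart_at u.1)))
    (coord (chart_at u) u).
  by apply: smooth_on_differentiable sT _; exists u.1.
(* The two difference quotients are convertible. *)
by rewrite -derive_fst_comp.
Qed.

(** The tangent transition is affine along the fibre. Together with [to_tangent_chart_fst] this says
    that J has the same expression in every induced chart. *)
Lemma to_tangent_chart_vertical c u v : atlas c -> dom c u.1 ->
  to_chart (N := TM) (tangent_chart c) u (0, v) = (0, to_chart c u.1 v).
Proof.
move=> ac du; rewrite to_tangent_chartE //; apply: derive_affine_line => h.
have dt := differentiable_transition hM (atlas_at hM u.1) ac (dom_at hM u.1) du.
rewrite /tangent_transition /=.
apply: injective_projections; rewrite /= ?scaler0 ?add0r ?addr0 //.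
by rewrite deriveDv // deriveZv // addrC.
Qed.

End TangentAtlas.

Lemma open_neq0 (R : realType) (U : normedModType R) : open [set v : U | v != 0].
Proof.
have -> : [set v : U | v != 0] = ~` [set 0].
  by apply/seteqP; split=> v /eqP.
exact/closed_openC/accessible_closed_set1/hausdorff_accessible/norm_hausdorff.
Qed.

(** * Differentials and dd_J in induced charts *)

Section TangentCalculus.
Context {R : realType} {n : nat} (M : charted 'rV[R]_n) (hM : smooth_atlas M).
Local Notation V := 'rV[R]_n.
Local Notation TM := (tangent M).
Let hT := smooth_atlas_tangent hM.
Implicit Types (c : chart M V) (u : TM) (p v w : V) (q X Y : V * V)
  (S : set TM) (f : TM -> R).

Definition vert_map : {linear V -> (V * V)%type} :=
  HB.pack (fun v : V => (0 : V, v))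
    (GRing.isLinear.Build _ _ _ _ _ (@pair0_is_linear R V V)).

Lemma verticalD v w : (0, v + w) = (0, v) + (0, w) :> V * V.
Proof. exact (linearD vert_map v w). Qed.

Lemma verticalZ (a : R) v : (0, a *: v) = a *: (0, v) :> V * V.
Proof. by rewrite -[LHS]/(vert_map _) linearZ. Qed.

Lemma mopen_slit : mopen (slit M).
Proof.
move=> _ [c ac <-].
have -> : coord (tangent_chart c) @` (slit M `&` dom (tangent_chart c)) =
    fst @^-1` (coord c @` dom c) `&` snd @^-1` [set v | v != 0].
  apply/seteqP; split=> [_ [u [yu du] <-]|q [[x dx xq] q2]].
    split; first by exists u.1.
    by rewrite /= (to_chart_eq0 hM).
  exists (x, of_chart c q.1 q.2); last first.
    by rewrite /= -xq (to_chartK hM _ ac dx) xq; case: q {xq q2}.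
  split=> //; rewrite /slit /= -(to_chart_eq0 hM _ ac dx).
  by rewrite -xq (to_chartK hM _ ac dx).
apply: openI.
  apply: open_comp => [q _|]; first exact: continuous_fst.
  by have := open_chart_image hM ac.
apply: open_comp => [q _|]; first exact: continuous_snd.
by have := @open_neq0 R V.
Qed.

Lemma tangent_imageP c S q : atlas c ->
  (coord (tangent_chart c) @` (S `&` dom (tangent_chart c))) q ->
  [/\ dom c (param (tangent_chart c) q).1, S (param (tangent_chart c) q) &
      coord (tangent_chart c) (param (tangent_chart c) q) = q].
Proof.
move=> ac /(chart_imageP hT _ _ (atlas_tangent ac))[_ d s e]; exact: And3.
Qed.

Lemma tangent_image_at u S : S u ->
  (coord (chart_at u) @` (S `&` dom (chart_at u))) (coord (chart_at u) u).
Proof. by move=> Su; exists u => //; split => //; exact: (dom_at hT u). Qed.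

Lemma param_at u : param (chart_at u) (coord (chart_at u) u) = u.
Proof. exact (sa_paramK hT (atlas_at hT u) (dom_at hT u)). Qed.

Lemma coord_at_snd u : (coord (chart_at u) u).2 = u.2.
Proof. exact: (to_chart_at hM). Qed.

(** [dfun] is defined through a preferred chart that changes with the point; differentiating it
    again requires all its values in one chart. *)
Lemma dfun_tangentE S f c q X : smooth_fun S f -> atlas c ->
  (coord (tangent_chart c) @` (S `&` dom (tangent_chart c))) q ->
  dfun f (param (tangent_chart c) q) X =
  'D_(to_chart (N := TM) (tangent_chart c) (param (tangent_chart c) q) X)
    (f \o param (tangent_chart c)) q.
Proof.
move=> sf ac Oq; have aC := atlas_tangent ac.
have [d s e] := tangent_imageP ac Oq.
have df : differentiable (f \o param (tangent_chart c))
    (coord (tangent_chart c) (param (tangent_chart c) q)).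
  by rewrite e; apply: smooth_on_differentiable (sf _ aC) Oq.
by have := dfunE hT X aC d df; rewrite e.
Qed.

Lemma dJE S f c q X : smooth_fun S f -> atlas c ->
  (coord (tangent_chart c) @` (S `&` dom (tangent_chart c))) q ->
  dJ f (param (tangent_chart c) q) X =
  'D_(0, to_chart c (param (tangent_chart c) q).1 X.1)
    (f \o param (tangent_chart c)) q.
Proof.
move=> sf ac Oq; have [d s e] := tangent_imageP ac Oq.
by rewrite /dJ (dfun_tangentE _ sf ac Oq) (to_tangent_chart_vertical hM).
Qed.

(** [ext_d] extends a vector Z with constant components, and J moves Z.1 into the fibre. So d_J f on
    the extension of Z is, at every point of the chart image, the derivative along the constant
    direction (0, Z.1). *)
Lemma ddJE S f u X Y : mopen S -> smooth_fun S f -> S u ->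
  ddJ f u X Y =
  'D_X ('D_(0, Y.1) (f \o param (chart_at u))) (coord (chart_at u) u) -
  'D_Y ('D_(0, X.1) (f \o param (chart_at u))) (coord (chart_at u) u).
Proof.
move=> oS sf Su.
have ac := atlas_at hM u.1; have aC := atlas_at hT u.
have Oq0 := tangent_image_at Su.
have rep Z q : (coord (chart_at u) @` (S `&` dom (chart_at u))) q ->
    dJ f (param (chart_at u) q) (of_chart (N := TM) (chart_at u) q Z) =
    'D_(0, Z.1) (f \o param (chart_at u)) q.
  move=> Oq; have [d s e] := tangent_imageP ac Oq.
  rewrite (dJE _ sf ac Oq); congr ('D_(0, _) _ _).
  rewrite -(to_tangent_chart_fst hM _ ac d) -[X in of_chart _ X]e.
  by rewrite (to_chartK hT).
have E1 := eq_on_derive X (oS _ aC) (rep Y) Oq0.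
have E2 := eq_on_derive Y (oS _ aC) (rep X) Oq0.
exact (f_equal2 (fun a b => a - b) E1 E2).
Qed.

End TangentCalculus.

(** * The metric tensor *)

Section FinslerCalculus.
Context {R : realType} {n : nat} (M : charted 'rV[R]_n) (hM : smooth_atlas M).
Local Notation V := 'rV[R]_n.
Local Notation TM := (tangent M).
Local Notation slit_image c :=
  (coord (tangent_chart c) @` (slit M `&` dom (tangent_chart c))).
Context (F : TM -> R) (hF : finsler F).
Local Notation L := (sq F).
Implicit Types (c : chart M V) (u : TM) (p v w z : V) (q X Y : V * V).

Lemma open_slit_image c : atlas c -> open (slit_image c).
Proof. by move=> ac; have := mopen_slit hM (atlas_tangent ac). Qed.

Lemma smooth_fun_mul (S : set TM) (f g : TM -> R) : mopen S ->
  smooth_fun S f -> smooth_fun S g -> smooth_fun S (fun x => f x * g x).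
Proof.
move=> oS sf sg C aC; exact: (smooth_on_mul (oS _ aC) (sf _ aC) (sg _ aC)).
Qed.

Lemma smooth_finsler : smooth_fun (slit M) F.
Proof. exact: cf_smooth (fin_slit hF). Qed.

Lemma smooth_energy : smooth_fun (slit M) L.
Proof. exact (smooth_fun_mul (mopen_slit hM) smooth_finsler smooth_finsler). Qed.

Lemma energy_homog c q (a : R) : atlas c -> slit_image c q -> 0 < a ->
  L (param (tangent_chart c) (q.1, a *: q.2)) =
  a ^+ 2 * L (param (tangent_chart c) q).
Proof.
move=> ac [u [yu du] <-] a0.
have -> : param (tangent_chart c)
    ((coord (tangent_chart c) u).1, a *: (coord (tangent_chart c) u).2) =
    dilate a (param (tangent_chart c) (coord (tangent_chart c) u)).
  rewrite /dilate /=; congr pair; exact: of_chartZ.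
by rewrite /sq (fin_homog hF) // exprMn.
Qed.

(** Differentiate L (x, (1 + t) y) = (1 + t)^2 L (x, y) at t = 0. Homogeneity concerns positive
    factors, so the equation is used only for t near 0, where 1 + t > 0. *)
Lemma euler c q : atlas c -> slit_image c q ->
  'D_(0, q.2) (L \o param (tangent_chart c)) q =
  2 * L (param (tangent_chart c) q).
Proof.
move=> ac Oq; set Lc := L \o _.
have dL : differentiable Lc q.
  exact: smooth_on_differentiable (smooth_energy (atlas_tangent ac)) Oq.
have q0 : q + (0 : R) *: (0, q.2) = q by rewrite scale0r addr0.
have dL0 : differentiable Lc (q + (0 : R) *: (0, q.2)) by rewrite q0.
have [_ D1] := is_derive_line dL0; rewrite q0 in D1; rewrite -D1.
pose g (t : R) : R := (1 + t) ^+ 2 * L (param (tangent_chart c) q).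
have -> : 'D_1 (fun s : R => Lc (q + s *: (0, q.2))) 0 = 'D_1 g 0.
  apply: near_eq_derive; near=> t.
  have t1 : 0 < 1 + t.
    have : `|t| < 1 by near: t; exact: (@nbhs0_lt R R 1 ltr01).
    by rewrite ltr_norml => /andP[h _]; rewrite -ltrBlDl sub0r.
  have e : q + t *: (0, q.2) = (q.1, (1 + t) *: q.2).
    apply: injective_projections; first by rewrite /= scaler0 addr0.
    by rewrite /= scalerDl scale1r.
  by rewrite e; exact: energy_homog ac Oq t1.
have d1 := is_deriveD (is_derive_cst (1 : R) (0 : R) 1)
  (@is_derive_id R R 0 1).
have d2 := is_deriveM (is_deriveX 2 d1)
  (is_derive_cst (L (param (tangent_chart c) q) : R) (0 : R) (1 : R)).
have -> : g = (cst 1 + id) ^+ 2 * cst (L (param (tangent_chart c) q)).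
  by apply/funext.
have [_ ->] := d2.
rewrite scaler0 add0r !fctE.
by rewrite addr0 add0r expr1n mulr1 /GRing.scale /= mulr1 mulrC.
Unshelve. all: by end_near. Qed.

End FinslerCalculus.

Section MetricTensor.
Context {R : realType} {n : nat} (M : charted 'rV[R]_n) (hM : smooth_atlas M).
Local Notation V := 'rV[R]_n.
Local Notation TM := (tangent M).
Local Notation slit_image c :=
  (coord (tangent_chart c) @` (slit M `&` dom (tangent_chart c))).
Context (F : TM -> R) (hF : finsler F).
Local Notation L := (sq F).
Local Notation Lhat u := (sq F \o param (chart_at (c := tangent M) u)).
Local Notation "'q_[' u ]" := (coord (chart_at (c := tangent M) u) u).
Implicit Types (c : chart M V) (u : TM) (p v w z : V) (q X Y : V * V).

Lemma derive_vertical0 (f : V * V -> R) q X : 'D_X ('D_(0, 0) f) q = 0.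
Proof.
have -> : 'D_(0, 0) f = cst 0 by apply/funext => x; exact: derive0.
exact: derive_cst.
Qed.

Lemma slit_image_at u : slit M u -> slit_image (chart_at u.1) q_[u].
Proof. by move=> su; exact: (tangent_image_at hM su). Qed.

Lemma open_slit_image_at u : open (slit_image (chart_at u.1)).
Proof. exact: open_slit_image hM _ (atlas_at hM u.1). Qed.

Lemma smooth_energy_at u : smooth_on (slit_image (chart_at u.1)) (Lhat u).
Proof. exact: (smooth_energy hM hF (atlas_tangent (atlas_at hM u.1))). Qed.

(** This is [euler] differentiated along Y; the direction (0, y) itself moves at the rate Y.2,
    whence the second term. *)
Lemma derive_euler c q Y : atlas c -> slit_image c q ->
  'D_Y ('D_(0, q.2) (L \o param (tangent_chart c))) q +
  'D_(0, Y.2) (L \o param (tangent_chart c)) q =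
  2 * 'D_Y (L \o param (tangent_chart c)) q.
Proof.
move=> ac Oq; set Lc := L \o _.
have oO := open_slit_image hM ac.
have sL : smooth_on (slit_image c) Lc := smooth_energy hM hF (atlas_tangent ac).
have dL : differentiable Lc q := smooth_on_differentiable sL Oq.
have := derive_derive_dir vert_map Y oO sL Oq (differentiable_snd q).
rewrite derive_snd => <-.
have e (p : V * V) : slit_image c p -> 'D_(vert_map p.2) Lc p = (2 *: Lc) p.
  by move=> Op; exact: (euler hM hF ac Op).
rewrite (eq_on_derive _ oO e Oq) deriveZ //; exact: diff_derivable.
Qed.

(** The other term of [ddJE] has inner direction (0, 0), since [gam v] has no x-components. *)
Lemma gmetE u v w : slit M u ->
  gmet F u v w = 2^-1 * 'D_(0, v) ('D_(0, w) (Lhat u)) q_[u].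
Proof.
move=> su; congr (_ * _).
have e := ddJE hM (gam v) (w, 0) (mopen_slit hM) (smooth_energy hM hF) su.
apply: etrans e (etrans _ (subr0 _)).
exact: (congr1 (fun a => _ - a) (derive_vertical0 (Lhat u) q_[u] (w, 0))).
Qed.

Lemma gmetC u v w : slit M u -> gmet F u v w = gmet F u w v.
Proof.
move=> su; rewrite (gmetE v w su) (gmetE w v su).
have e := smooth_on_schwarz (0, v) (0, w) (@open_slit_image_at u)
  (@smooth_energy_at u) (slit_image_at su).
exact (congr1 (fun a => 2^-1 * a) e).
Qed.

Lemma gmetDl u v v' w : slit M u ->
  gmet F u (v + v') w = gmet F u v w + gmet F u v' w.
Proof.
move=> su; rewrite (gmetE v w su) (gmetE v' w su) (gmetE (v + v') w su).
have d : differentiable ('D_(0, w) (Lhat u)) q_[u].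
  apply: smooth_on_differentiable (slit_image_at su).
  exact/smooth_on_derive/smooth_energy_at.
by rewrite verticalD (deriveDv _ _ d) mulrDr.
Qed.

Lemma gmetZl u a v w : slit M u -> gmet F u (a *: v) w = a * gmet F u v w.
Proof.
move=> su; rewrite (gmetE v w su) (gmetE (a *: v) w su).
have d : differentiable ('D_(0, w) (Lhat u)) q_[u].
  apply: smooth_on_differentiable (slit_image_at su).
  exact/smooth_on_derive/smooth_energy_at.
by rewrite verticalZ (deriveZv _ _ d) mulrCA.
Qed.

Lemma gmetNl u v w : slit M u -> gmet F u (- v) w = - gmet F u v w.
Proof. by move=> su; rewrite -scaleN1r (gmetZl _ _ _ su) mulN1r. Qed.

(** Take Y = (0, v) in [derive_euler]: one of the two copies of dL(0, v) on the right cancels. *)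
Lemma gmet_eta u v : slit M u -> gmet F u (etabar u) v = 2^-1 * dfun L u (0, v).
Proof.
move=> su; rewrite (gmetC _ _ su) (gmetE _ _ su).
have e := derive_euler (0, v) (atlas_at hM u.1) (slit_image_at su).
rewrite (coord_at_snd hM) /= in e.
apply: (congr1 (fun a => 2^-1 * a)); apply: (addIr ('D_(0, v) (Lhat u) q_[u])).
by apply: (etrans e); rewrite mulr_natl mulr2n.
Qed.

Lemma gmet_eta_eta u : slit M u -> gmet F u (etabar u) (etabar u) = F u ^+ 2.
Proof.
move=> su; rewrite (gmet_eta _ su).
have := euler hM hF (atlas_at hM u.1) (slit_image_at su).
rewrite (coord_at_snd hM) -[tangent_chart _]/(chart_at u) (param_at hM) => e.
rewrite /dfun; apply: etrans (congr1 _ e) _.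
by rewrite mulrA mulVf ?mul1r ?pnatr_eq0.
Qed.

End MetricTensor.

(** * The function b and the squared norm of A *)

Section ConcurrentField.
Context {R : realType} {n : nat} (M : charted 'rV[R]_n) (hM : smooth_atlas M).
Local Notation V := 'rV[R]_n.
Local Notation TM := (tangent M).
Local Notation slit_image c :=
  (coord (tangent_chart c) @` (slit M `&` dom (tangent_chart c))).
Context (F : TM -> R) (hF : finsler F).
Local Notation L := (sq F).
Local Notation hat f u := (f \o param (chart_at (c := tangent M) u)).
Local Notation "'q_[' u ]" := (coord (chart_at (c := tangent M) u) u).
Let hT := smooth_atlas_tangent hM.
Implicit Types (c : chart M V) (u : TM) (p v w z : V) (q X Y : V * V).

(** Convertible to the function required to be smooth in [smooth_pivf], so that the smoothness of A
    applies to it directly. *)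
Definition pivf_rep c (Z : TM -> V) (q : V * V) : V :=
  to_chart c (param (tangent_chart c) q).1 (Z (param (tangent_chart c) q)).

Lemma pivf_rep_at u Z : pivf_rep (chart_at u.1) Z q_[u] = Z u.
Proof.
by rewrite /pivf_rep -[tangent_chart _]/(chart_at u) (param_at hM) (to_chart_at hM).
Qed.

Context (A : TM -> V) (sA : smooth_pivf (slit M) A).
Local Notation b := (Bfun F A).

(** Euler's relation replaces the second derivatives of L in the definition of b by a first
    derivative; smoothness of b and the formula for db start from here. *)
Lemma Bfun_energy u : slit M u -> b u = 2^-1 * dfun L u (0, A u).
Proof. by move=> su; rewrite /Bfun /Bform (gmetC hM hF _ _ su) (gmet_eta hM hF _ su). Qed.

Lemma Bfun_rep c q : atlas c -> slit_image c q ->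
  b (param (tangent_chart c) q) =
  2^-1 * 'D_(vert_map (pivf_rep c A q)) (L \o param (tangent_chart c)) q.
Proof.
move=> ac Oq; have [d s e] := tangent_imageP hM ac Oq.
have e2 := dJE hM (A (param (tangent_chart c) q), 0) (smooth_energy hM hF) ac Oq.
apply: etrans (Bfun_energy s) _.
exact (congr1 (fun a => 2^-1 * a) e2).
Qed.

Lemma smooth_Bfun : smooth_fun (slit M) b.
Proof.
move=> _ [c ac <-]; have oO := open_slit_image hM ac.
have sL := smooth_energy hM hF (atlas_tangent ac).
have sD := smooth_on_derive_dir vert_map oO sL (sA ac).
have s2 := smooth_on_mul oO (smooth_on_cst (2^-1 : R)) sD.
apply: smooth_on_ext oO _ s2 => q Oq; exact (esym (Bfun_rep ac Oq)).
Qed.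

Lemma dfun_Bfun u X : slit M u ->
  dfun b u X = 2^-1 * ('D_X ('D_(0, A u) (hat L u)) q_[u] +
    'D_(0, 'D_X (pivf_rep (chart_at u.1) A) q_[u]) (hat L u) q_[u]).
Proof.
move=> su; have ac := atlas_at hM u.1.
have oO := open_slit_image hM ac; have Oq := slit_image_at hM su.
have sL := smooth_energy hM hF (atlas_tangent ac).
have dA : differentiable (pivf_rep (chart_at u.1) A) q_[u].
  exact: (smooth_on_differentiable (sA ac) Oq).
have := derive_derive_dir vert_map X oO sL Oq dA; rewrite pivf_rep_at => e.
apply: etrans (eq_on_derive X oO (fun q Oq => Bfun_rep ac Oq) Oq) _.
have dD := smooth_on_differentiable (smooth_on_derive_dir vert_map oO sL (sA ac)) Oq.
have eZ := deriveZ (2^-1 : R) (diff_derivable (v := X) dD).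
apply: etrans eZ _.
exact (congr1 (fun a => 2^-1 * a) e).
Qed.

Context (Av : forall u z, slit M u ->
  'D_(0, z) (pivf_rep (chart_at u.1) A) q_[u] = 0).

(** The components of A being constant along fibres, only the first term of [dfun_Bfun] survives,
    and it is the second vertical derivative that defines g. *)
Lemma dfun_Bfun_vertical u z : slit M u -> dfun b u (0, z) = gmet F u (A u) z.
Proof.
move=> su; apply: etrans (dfun_Bfun (0, z) su) _.
rewrite (Av z su) (gmetC hM hF _ _ su) (gmetE hM hF _ _ su).
apply: (congr1 (fun a => 2^-1 * a)); apply: etrans _ (addr0 _).
exact (congr1 (fun a => _ + a) (derive0 _ _)).
Qed.

Lemma normA2_Bfun u : slit M u -> normA2 F A u = dfun b u (0, A u).
Proof. by move=> su; rewrite (dfun_Bfun_vertical _ su). Qed.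

Lemma normA2_rep c q : atlas c -> slit_image c q ->
  normA2 F A (param (tangent_chart c) q) =
  'D_(vert_map (pivf_rep c A q)) (b \o param (tangent_chart c)) q.
Proof.
move=> ac Oq; have [d s e] := tangent_imageP hM ac Oq.
apply: etrans (normA2_Bfun s) _.
exact: (dJE hM (A (param (tangent_chart c) q), 0) smooth_Bfun ac Oq).
Qed.

Lemma smooth_normA2 : smooth_fun (slit M) (normA2 F A).
Proof.
move=> _ [c ac <-]; have oO := open_slit_image hM ac.
have sD := smooth_on_derive_dir vert_map oO (smooth_Bfun (atlas_tangent ac)) (sA ac).
apply: smooth_on_ext oO _ sD => q Oq; exact (esym (normA2_rep ac Oq)).
Qed.

Context (da : forall u X, slit M u ->
  dfun (normA2 F A) u X = - 2 * gmet F u (A u) X.1).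

(** Both sides are multiples of g(A, rho Y'), where Y' has the components Y in the chart [c].
    Holding throughout the chart image with Y fixed, the equation can be differentiated once
    more. *)
Lemma derive_Bfun_vertical c q Y : atlas c -> slit_image c q ->
  'D_(0, Y.1) (b \o param (tangent_chart c)) q =
  - 2^-1 * 'D_Y (normA2 F A \o param (tangent_chart c)) q.
Proof.
move=> ac Oq; have [d s e] := tangent_imageP hM ac Oq.
have aC := atlas_tangent ac.
pose Y' := of_chart (N := TM) (tangent_chart c) q Y.
have tY : to_chart (N := TM) (tangent_chart c) (param (tangent_chart c) q) Y' = Y.
  by rewrite /Y' -[X in of_chart _ X]e (to_chartK hT).
have e1 := dJE hM Y' smooth_Bfun ac Oq.
have e2 := dfun_tangentE hM Y' smooth_normA2 ac Oq.
rewrite tY in e2.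
rewrite -(to_tangent_chart_fst hM _ ac d) tY in e1.
have e3 : dJ b (param (tangent_chart c) q) Y' =
    - 2^-1 * dfun (normA2 F A) (param (tangent_chart c) q) Y'.
  have h : 2^-1 * 2 = 1 :> R by rewrite mulVf ?pnatr_eq0.
  rewrite (da Y' s) mulrA mulrNN h mul1r.
  exact: (dfun_Bfun_vertical Y'.1 s).
exact (etrans (esym e1) (etrans e3 (congr1 (fun a => - 2^-1 * a) e2))).
Qed.

(* [d_J b] is [- 1/2 d |A|^2], hence closed. *)
Lemma ddJ_Bfun u X Y : slit M u -> ddJ b u X Y = 0.
Proof.
move=> su; have ac := atlas_at hM u.1.
have oO := open_slit_image hM ac; have Oq := slit_image_at hM su.
apply: etrans (ddJE hM X Y (mopen_slit hM) smooth_Bfun su) _.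
have sa := smooth_normA2 (atlas_tangent ac).
have E Z W : 'D_W ('D_(0, Z.1) (hat b u)) q_[u] =
    - 2^-1 * 'D_W ('D_Z (hat (normA2 F A) u)) q_[u].
  apply: etrans (eq_on_derive W oO (fun q Oq => derive_Bfun_vertical Z ac Oq) Oq) _.
  have dD := smooth_on_differentiable (smooth_on_derive Z sa) Oq.
  exact (deriveZ (- 2^-1 : R) (diff_derivable (v := W) dD)).
apply: etrans (congr2 (fun a a' => a - a') (E Y X) (E X Y)) _.
have e := smooth_on_schwarz X Y oO sa Oq.
apply/eqP; rewrite subr_eq0; apply/eqP.
exact (congr1 (fun a => - 2^-1 * a) e).
Qed.

End ConcurrentField.

(** * Connections *)

Section Connections.
Context {R : realType} {n : nat} (M : charted 'rV[R]_n) (hM : smooth_atlas M).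
Local Notation V := 'rV[R]_n.
Local Notation TM := (tangent M).
Local Notation slit_image c :=
  (coord (tangent_chart c) @` (slit M `&` dom (tangent_chart c))).
Let hT := smooth_atlas_tangent hM.
Implicit Types (c : chart M V) (u w : TM) (v z : V) (q X Y : V * V).

Lemma near_slit (P : set TM -> Prop) u : slit M u -> P (slit M) -> near_pt P u.
Proof. by move=> su Ps; exists (slit M); split=> //; exact: mopen_slit. Qed.

Lemma dfun_ext (S : set TM) (f g : TM -> R) u X : mopen S ->
  (forall w, S w -> f w = g w) -> S u -> dfun f u X = dfun g u X.
Proof.
move=> oS fg Su; have aC := atlas_at hT u.
apply: (eq_on_derive X (oS _ aC) _ (tangent_image_at hM Su)) => q Oq.
have [d s e] := tangent_imageP hM (atlas_at hM u.1) Oq.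
exact: fg.
Qed.

Lemma smooth_pivf_ext (S : set TM) (Y Y' : TM -> V) : mopen S ->
  (forall w, S w -> Y w = Y' w) -> smooth_pivf S Y -> smooth_pivf S Y'.
Proof.
move=> oS YY sY c ac; have aC := atlas_tangent ac.
apply: smooth_on_ext (oS _ aC) _ (sY _ ac) => q Oq.
by have [d s e] := tangent_imageP hM ac Oq; rewrite /= YY.
Qed.

Lemma smooth_pivf0 (S : set TM) : smooth_pivf S (fun _ => 0).
Proof.
move=> c ac.
have -> : (fun q => let u := param (tangent_chart c) q in to_chart c u.1 0) =
    cst (0 : V) by apply/funext => q; exact: to_chart0.
exact: smooth_on_cst.
Qed.

Lemma smooth_pivf_eta : smooth_pivf (slit M) (@etabar R n M).
Proof.
move=> c ac; have oO := open_slit_image hM ac.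
apply: smooth_on_ext oO _ (smooth_on_snd oO) => q Oq.
have [d s e] := tangent_imageP hM ac Oq.
exact (esym (congr1 snd e)).
Qed.

(** The indicator f of the slit bundle is smooth there with df = 0, so Leibniz gives D (f Y) = D Y,
    and likewise for Y'; but f Y and f Y' are the same function everywhere. This is what allows rho
    (beta Y) to be replaced by Y, as the two are known to agree only off the zero section. *)
Lemma connection_slit_ext (D : pre_connection M) u X (Y Y' : TM -> V) :
  connection D -> slit M u -> smooth_pivf (slit M) Y ->
  (forall w, slit M w -> Y w = Y' w) -> D u X Y' = D u X Y.
Proof.
move=> cD su sY YY.
have sY' := smooth_pivf_ext (mopen_slit hM) YY sY.
pose f (w : TM) : R := if w.2 != 0 then 1 else 0.
have f1 w : slit M w -> f w = 1 by rewrite /f /slit /= => ->.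
have sf : smooth_fun (slit M) f.
  move=> _ [c ac <-].
  apply: smooth_on_ext (open_slit_image hM ac) _ (smooth_on_cst (1 : R)) => q Oq.
  by have [d s e] := tangent_imageP hM ac Oq; rewrite /= f1.
have df0 : dfun f u X = 0.
  rewrite (dfun_ext X (g := cst 1) (mopen_slit hM) f1 su).
  exact: derive_cst.
have key Z : smooth_pivf (slit M) Z -> D u X (fun w => f w *: Z w) = D u X Z.
  move=> sZ.
  have nf : near_pt (fun S => smooth_fun S f) u by exact: near_slit su sf.
  have nZ : near_pt (fun S => smooth_pivf S Z) u by exact: near_slit su sZ.
  rewrite (conn_leibniz cD su nf nZ) df0 (f1 u su).
  by rewrite scale0r add0r scale1r.
rewrite -(key _ sY) -(key _ sY'); congr (D u X _); apply/funext => w.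
rewrite /f; case: ifPn => [sw|_]; last by rewrite !scale0r.
by rewrite YY.
Qed.

Lemma connection0 (D : pre_connection M) u X :
  connection D -> slit M u -> D u X (fun _ => 0) = 0.
Proof.
move=> cD su; have s0 : near_pt (fun S => smooth_pivf S (fun _ : TM => 0 : V)) u.
  by apply: near_slit su _; exact: smooth_pivf0.
apply: (addIr (D u X (fun _ => 0))); rewrite add0r.
rewrite -(conn_add cD su s0 s0); congr (D u X _).
by apply/funext => w; rewrite addr0.
Qed.

Lemma mopen_slit_dom c : atlas c -> mopen (slit M `&` [set w : TM | dom c w.1]).
Proof.
move=> ac _ [c' ac' <-].
have -> : coord (tangent_chart c') @` (slit M `&` [set w : TM | dom c w.1]
      `&` dom (tangent_chart c')) =
    slit_image c' `&` fst @^-1` (coord c' @` (dom c' `&` dom c)).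
  apply/seteqP; split=> [_ [w [[sw dw] dw'] <-]|_ [[w [sw dw'] <-] [x [dx' dx] xw]]].
    by split; [exists w|exists w.1].
  exists w => //; split=> //; split=> //=.
  by rewrite -(sa_paramK hM ac' dw') -[coord c' w.1]xw (sa_paramK hM ac' dx').
apply: openI; first exact: open_slit_image hM _ ac'.
apply: open_comp => [q _|]; first exact: continuous_fst.
by have := sa_overlap hM ac' ac.
Qed.

(** A test field for the Berwald torsion: its components in the induced chart of [c] are the
    constants (0, z), so it contributes no derivative to a bracket computed there. *)
Definition const_vertical c z : TM -> V * V :=
  fun w => gam (of_chart c (coord c w.1) z).

Lemma smooth_const_vertical c z : atlas c ->
  smooth_vf (slit M `&` [set w : TM | dom c w.1]) (const_vertical c z).
Proof.
move=> ac _ [c' ac' <-]; have oS := mopen_slit_dom ac (atlas_tangent ac').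
set O := _ @` _ in oS *.
have oT := sa_overlap hM ac ac'; have oT' := sa_overlap hM ac' ac.
have s1 : smooth_on O (fst : V * V -> V) := smooth_on_fst oS.
have OP q : O q -> exists2 x, dom c' x /\ dom c x & coord c' x = q.1.
  by move=> [w [[sw dw] dw'] <-]; exists w.1.
have OT' q : O q -> (coord c' @` (dom c' `&` dom c)) q.1.
  by move=> /OP[x [dx' dx] xq]; exists x.
have s2 := smooth_on_comp oS oT' OT' s1 (sa_transition hM ac' ac).
have OT q : O q -> (coord c @` (dom c `&` dom c')) (((coord c \o param c') \o fst) q).
  move=> /OP[x [dx' dx] xq]; exists x => //.
  by rewrite /= -xq (sa_paramK hM ac' dx').
have s3 := smooth_on_comp oS oT OT s2 (smooth_on_derive z (sa_transition hM ac ac')).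
apply: smooth_on_ext oS _ (smooth_on_pair oS (smooth_on_cst (0 : V)) s3) => q Oq.
have [d [s d'] e] := tangent_imageP hM ac' Oq.
rewrite /vf_rep /const_vertical (to_tangent_chart_vertical hM _ ac' d).
congr pair; rewrite (to_chart_of_chart hM _ ac ac' d' d).
by [].
Qed.

End Connections.

(** * Consequences of the connection axioms for A, b and L *)

Section ConcurrentGeometry.
Context {R : realType} {n : nat} (M : charted 'rV[R]_n) (hM : smooth_atlas M).
Local Notation V := 'rV[R]_n.
Local Notation TM := (tangent M).
Local Notation slit_image c :=
  (coord (tangent_chart c) @` (slit M `&` dom (tangent_chart c))).
Local Notation "'q_[' u ]" := (coord (chart_at (c := tangent M) u) u).
Let hT := smooth_atlas_tangent hM.
Implicit Types (c : chart M V) (u w : TM) (v z : V) (q X Y : V * V).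

Context (F : TM -> R) (hF : finsler F) (nabla Dc : pre_connection M)
  (hnabla : cartan_connection F nabla) (hDc : berwald_connection F Dc)
  (beta : TM -> V -> V * V) (hbeta : horizontal_map nabla beta)
  (A : TM -> V) (hA : concurrent nabla Dc beta A).
Local Notation L := (sq F).
Local Notation b := (Bfun F A).

Let sA : smooth_pivf (slit M) A := conc_smooth hA.

Let near_eta u : slit M u -> near_pt (fun S => smooth_pivf S (@etabar R n M)) u.
Proof. by move=> su; apply: (near_slit hM su); exact: smooth_pivf_eta. Qed.

Let near_A u : slit M u -> near_pt (fun S => smooth_pivf S A) u.
Proof. by move=> su; apply: (near_slit hM su); exact: sA. Qed.

Lemma beta_rho (Y : TM -> V) w : slit M w -> Y w = (rho \o (fun w => beta w (Y w))) w.
Proof. by move=> sw; rewrite /= (hmap_rho hbeta). Qed.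

Lemma vf_rep_beta_fst (Y : TM -> V) c q : atlas c -> slit_image c q ->
  (vf_rep (N := TM) (tangent_chart c) (fun w => beta w (Y w)) q).1 = pivf_rep c Y q.
Proof.
move=> ac Oq; have [d s e] := tangent_imageP hM ac Oq.
rewrite /vf_rep (to_tangent_chart_fst hM _ ac d).
by rewrite -[(beta _ _).1]/(rho _) (hmap_rho hbeta).
Qed.

(** The image of a bracket under rho involves only x-components, and those of beta Y are the
    components of Y. [hmap_smooth] provides the differentiability needed to project the
    derivative. *)
Lemma derive_vf_rep_beta_fst (Y : TM -> V) u X : slit M u ->
  smooth_pivf (slit M) Y ->
  ('D_X (vf_rep (N := TM) (chart_at u) (fun w => beta w (Y w))) q_[u]).1 =
  'D_X (pivf_rep (chart_at u.1) Y) q_[u].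
Proof.
move=> su sY; have ac := atlas_at hM u.1; have aC := atlas_at hT u.
have nY : near_pt (fun S => smooth_pivf S Y) u.
  by apply: (near_slit hM su); exact: sY.
have [S [oS Su sB]] := hmap_smooth hbeta su nY.
have dB := smooth_on_differentiable (sB _ aC) (tangent_image_at hM Su).
rewrite -(derive_fst_comp _ dB).
apply: (eq_on_derive X (open_slit_image hM ac) _ (slit_image_at hM su)) => q Oq.
exact: vf_rep_beta_fst ac Oq.
Qed.

(* The Berwald torsion of a vertical and a horizontal field is the vertical
   derivative of the components of [A]. *)
Lemma concurrent_vertical u z : slit M u ->
  'D_(0, z) (pivf_rep (chart_at u.1) A) q_[u] = 0.
Proof.
move=> su; have ac := atlas_at hM u.1; have dx := dom_at hM u.1.
have cD := berwald_conn hDc.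
pose X := const_vertical (chart_at u.1) z : TM -> V * V.
pose Y w := beta w (A w).
have nX : near_pt (fun S => smooth_vf S X) u.
  exists (slit M `&` [set w : TM | dom (chart_at u.1) w.1]).
  split=> //; first exact: mopen_slit_dom.
  exact: smooth_const_vertical.
have nY : near_pt (fun S => smooth_vf S Y) u := hmap_smooth hbeta su (near_A su).
have Xu : X u = (0, z).
  rewrite /X /const_vertical /gam; congr pair.
  by rewrite -[LHS](to_chart_at hM u.1) (to_chartK hM _ ac dx).
have t0 := berwald_torsion hDc su nX nY; rewrite /torsion in t0.
have e1 : Dc u (X u) (rho \o Y) = 0.
  rewrite (connection_slit_ext hM (X u) cD su sA (beta_rho A)) Xu.
  exact: (conc_berwald_v hA z su).
have e2 : Dc u (Y u) (rho \o X) = 0.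
  exact (connection0 hM (Y u) cD su).
rewrite e1 e2 subrr sub0r in t0.
have e3 : rho (lie_bracket X Y u) = 0 by rewrite -[LHS]opprK t0 oppr0.
have vX : 'D_(Y u) (vf_rep (N := TM) (chart_at u) X) q_[u] = 0.
  rewrite -(derive_cst ((0, z) : V * V) q_[u] (Y u)).
  apply: (eq_on_derive (Y u) (open_slit_image hM ac) _ (slit_image_at hM su)) => q Oq.
  have [d s e] := tangent_imageP hM ac Oq.
  rewrite /vf_rep /X /const_vertical (to_tangent_chart_vertical hM _ ac d).
  by rewrite (to_chartK hM _ ac d).
rewrite -(derive_vf_rep_beta_fst _ su sA).
have e4 : lie_bracket X Y u =
    'D_(X u) (vf_rep (N := TM) (chart_at u) Y) q_[u] - 0.
  exact (congr1 (fun a => 'D_(X u) (vf_rep (N := TM) (chart_at u) Y) q_[u] - a) vX).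
rewrite e4 subr0 Xu in e3.
exact e3.
Qed.

(** The factor [1 *:] gives the decomposition the shape expected by [conn_linear]. *)
Lemma split_beta u X : slit M u ->
  X = 1 *: beta u X.1 + gam (X.2 - (beta u X.1).2).
Proof.
move=> su; rewrite scale1r; apply: injective_projections => /=.
  by rewrite -[(beta _ _).1]/(rho _) (hmap_rho hbeta) // addr0.
by rewrite addrC subrK.
Qed.

Lemma nabla_concurrent u X : slit M u -> nabla u X A = - X.1.
Proof.
move=> su; have cN := cartan_conn hnabla.
rewrite {1}(split_beta X su) (conn_linear cN su (near_A su)) scale1r.
by rewrite (conc_cartan_h hA _ su) (conc_cartan_v hA _ su) addr0.
Qed.

Lemma dfun_normA2 u X : slit M u ->
  dfun (normA2 F A) u X = - 2 * gmet F u (A u) X.1.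
Proof.
move=> su.
have e := cartan_metric hnabla su (near_A su) (near_A su) X.
rewrite (nabla_concurrent X su) in e.
rewrite (gmetC hM hF (A u) (- X.1) su) (gmetNl hM hF _ _ su) in e.
rewrite (gmetC hM hF X.1 (A u) su) in e.
apply: etrans e _; ring.
Qed.

Lemma nabla_eta u z : slit M u -> nabla u (beta u z) (@etabar R n M) = 0.
Proof. by move=> su; exact: (hmap_horizontal hbeta z su). Qed.

Lemma gmet0l u v : slit M u -> gmet F u 0 v = 0.
Proof. by move=> su; rewrite -(scale0r (0 : V)) (gmetZl hM hF _ _ _ su) mul0r. Qed.

(** L = g(eta, eta), the connection is metric, and eta is parallel along horizontal vectors by their
    definition. *)
Lemma dfun_energy_horizontal u z : slit M u -> dfun L u (beta u z) = 0.
Proof.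
move=> su.
have e := cartan_metric hnabla su (near_eta su) (near_eta su) (beta u z).
rewrite (nabla_eta z su) (gmetC hM hF (etabar u) 0 su) (gmet0l _ su) addr0 in e.
rewrite -e; apply: (dfun_ext hM _ (mopen_slit hM) _ su) => w sw.
by rewrite (gmet_eta_eta hM hF sw).
Qed.

(** Metricity for b = g(A, eta) along beta eta, where A has derivative - eta and eta has derivative
    0. *)
Lemma dfun_Bfun_horizontal u : slit M u ->
  dfun b u (beta u (etabar u)) = - F u ^+ 2.
Proof.
move=> su.
have e := cartan_metric hnabla su (near_A su) (near_eta su) (beta u (etabar u)).
rewrite (nabla_eta _ su) (gmetC hM hF (A u) 0 su) (gmet0l _ su) addr0 in e.
rewrite (nabla_concurrent _ su) -[(beta _ _).1]/(rho _) (hmap_rho hbeta _ su) in e.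
rewrite (gmetNl hM hF _ _ su) (gmet_eta_eta hM hF su) in e.
exact: e.
Qed.

(* The (h)h-torsion of [beta eta] and [beta A] vanishes. *)
Lemma derive_concurrent_horizontal u : slit M u ->
  'D_(beta u (etabar u)) (pivf_rep (chart_at u.1) A) q_[u] =
  (beta u (A u)).2 - etabar u.
Proof.
move=> su; have ac := atlas_at hM u.1; have cN := cartan_conn hnabla.
have t0 := cartan_hh hnabla hbeta su (near_eta su) (near_A su).
rewrite /torsion in t0.
rewrite (connection_slit_ext hM _ cN su sA (beta_rho A)) in t0.
rewrite (connection_slit_ext hM _ cN su (smooth_pivf_eta hM)
  (beta_rho (@etabar R n M))) in t0.
rewrite (nabla_eta _ su) (nabla_concurrent _ su) -[(beta _ _).1]/(rho _) in t0.
rewrite (hmap_rho hbeta _ su) subr0 in t0.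
rewrite -(derive_vf_rep_beta_fst _ su sA).
have e : ('D_(beta u (A u))
    (vf_rep (N := TM) (chart_at u) (fun w => beta w (etabar w))) q_[u]).1 =
    (beta u (A u)).2.
  rewrite (derive_vf_rep_beta_fst _ su (smooth_pivf_eta hM)).
  apply: etrans _ (derive_snd q_[u] (beta u (A u))).
  apply: (eq_on_derive _ (open_slit_image hM ac) _ (slit_image_at hM su)) => q Oq.
  have [d s e] := tangent_imageP hM ac Oq.
  exact (congr1 snd e).
rewrite -e; apply/eqP; rewrite -subr_eq0 opprB addrA addrAC; apply/eqP.
by rewrite -[RHS]oppr0 -t0 opprB opprK addrC.
Qed.

End ConcurrentGeometry.

(** The arithmetic of [ddJ_energy_horizontal], with f = F^2. There d1 and d3 are the second
    derivatives of L along (beta eta, gamma A) and (beta A, gamma eta), outer direction first and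
    inner direction frozen or moving as stated by the formulas used; d2, d4, d5 are the vertical
    derivatives of L along the derivative of A, the y-part of beta A, and y. *)
Lemma energy_balance (R : realFieldType) (f d1 d2 d3 d4 d5 : R) :
  - f = 2^-1 * (d1 + d2) -> d3 + d4 = 0 -> d5 = 2 * f -> d2 = d4 - d5 ->
  d1 - d3 = 0.
Proof. by move=> h1 h2 h3 h4; lra. Qed.

(** * Linearity of dd_J in its first argument *)

Section DdJLinear.
Context {R : realType} {n : nat} (M : charted 'rV[R]_n) (hM : smooth_atlas M).
Local Notation V := 'rV[R]_n.
Local Notation TM := (tangent M).
Let hT := smooth_atlas_tangent hM.
Implicit Types (u : TM) (X Y : V * V).

(** The first argument occurs as an outer direction at one point and, through its x-components, as
    an inner direction; the latter needs additivity at all nearby points before differentiating. *)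
Lemma ddJDl (S : set TM) (f : TM -> R) u X X' Y : mopen S -> smooth_fun S f -> S u ->
  ddJ f u (X + X') Y = ddJ f u X Y + ddJ f u X' Y.
Proof.
move=> oS sf Su; have aC := atlas_at hT u; have Oq := tangent_image_at hM Su.
have oO := oS _ aC.
set C := chart_at u in aC oO Oq; set q := coord C u in Oq.
have dd v w : derivable ('D_v (f \o param C)) q w.
  apply: diff_derivable; apply: (smooth_on_differentiable _ Oq).
  exact: smooth_on_derive (sf _ aC).
have e1 := ddJE hM X Y oS sf Su; have e2 := ddJE hM X' Y oS sf Su.
have e3 := ddJE hM (X + X') Y oS sf Su.
apply: (etrans e3); rewrite e1 e2 [RHS]addrACA -opprD.
have dY : differentiable ('D_(0, Y.1) (f \o param C)) q.
  apply: (smooth_on_differentiable _ Oq); exact: smooth_on_derive (sf _ aC).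
have e4 := deriveDv X X' dY.
have e5 p : (coord C @` (S `&` dom C)) p ->
    'D_(0, (X + X').1) (f \o param C) p =
    ('D_(0, X.1) (f \o param C) + 'D_(0, X'.1) (f \o param C)) p.
  move=> Op; have df := smooth_on_differentiable (sf _ aC) Op.
  have e : (0, (X + X').1) = (0, X.1) + (0, X'.1) :> V * V.
    exact (verticalD X.1 X'.1).
  exact (etrans (congr1 (fun v => 'D_v (f \o param C) p) e)
    (deriveDv (0, X.1) (0, X'.1) df)).
have e6 := etrans (eq_on_derive Y oO e5 Oq) (deriveD (dd (0, X.1) Y) (dd (0, X'.1) Y)).
exact (congr2 (fun a a' => a - a') e4 e6).
Qed.

Lemma ddJZl (S : set TM) (f : TM -> R) u (a : R) X Y : mopen S -> smooth_fun S f ->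
  S u -> ddJ f u (a *: X) Y = a * ddJ f u X Y.
Proof.
move=> oS sf Su; have aC := atlas_at hT u; have Oq := tangent_image_at hM Su.
have oO := oS _ aC.
set C := chart_at u in aC oO Oq; set q := coord C u in Oq.
have dd v w : derivable ('D_v (f \o param C)) q w.
  apply: diff_derivable; apply: (smooth_on_differentiable _ Oq).
  exact: smooth_on_derive (sf _ aC).
have e1 := ddJE hM X Y oS sf Su.
have e3 := ddJE hM (a *: X) Y oS sf Su.
apply: (etrans e3); rewrite e1 mulrBr.
have dY : differentiable ('D_(0, Y.1) (f \o param C)) q.
  apply: (smooth_on_differentiable _ Oq); exact: smooth_on_derive (sf _ aC).
have e4 := deriveZv a X dY.
have e5 p : (coord C @` (S `&` dom C)) p ->
    'D_(0, (a *: X).1) (f \o param C) p = (a *: 'D_(0, X.1) (f \o param C)) p.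
  move=> Op; have df := smooth_on_differentiable (sf _ aC) Op.
  have e : (0, (a *: X).1) = a *: (0, X.1) :> V * V.
    exact (verticalZ a X.1).
  exact (etrans (congr1 (fun v => 'D_v (f \o param C) p) e)
    (deriveZv a (0, X.1) df)).
have e6 := etrans (eq_on_derive Y oO e5 Oq) (deriveZ a (dd (0, X.1) Y)).
exact (congr2 (fun a a' => a - a') e4 e6).
Qed.

End DdJLinear.

(** * The canonical spray of F and its action on L and b *)

Section Spray.
Context {R : realType} {n : nat} (M : charted 'rV[R]_n) (hM : smooth_atlas M).
Local Notation V := 'rV[R]_n.
Local Notation TM := (tangent M).
Local Notation hat f u := (f \o param (chart_at (c := tangent M) u)).
Local Notation "'q_[' u ]" := (coord (chart_at (c := tangent M) u) u).
Let hT := smooth_atlas_tangent hM.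
Implicit Types (u w : TM) (v z : V) (q X Y : V * V).
Context (F : TM -> R) (hF : finsler F).
Local Notation L := (sq F).

Lemma ddJ_energy_vertical u v Y : slit M u ->
  ddJ L u (gam v) Y = 2 * gmet F u v Y.1.
Proof.
move=> su; rewrite (gmetE hM hF _ _ su).
have e := ddJE hM (gam v) Y (mopen_slit hM) (smooth_energy hM hF) su.
have e0 := derive_vertical0 (hat L u) q_[u] Y.
have e1 : ddJ L u (gam v) Y = 'D_(0, v) ('D_(0, Y.1) (hat L u)) q_[u] - 0.
  exact (etrans e (congr1
    (fun a => 'D_(0, v) ('D_(0, Y.1) (hat L u)) q_[u] - a) e0)).
rewrite e1 subr0 mulrA mulfV ?mul1r //.
Qed.

Lemma spray_fst S (f : TM -> R) G u : canonical_spray S f G -> S u ->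
  (G u).1 = etabar u.
Proof. by move=> hG Su; have := congr1 snd (spray_J hG Su). Qed.

(** On the pair (G, G) the two terms of [ext_d] coincide. *)
Lemma dfun_spray S (f : TM -> R) G u : canonical_spray S f G -> S u ->
  dfun (sq f) u (G u) = 0.
Proof.
move=> hG Su; have := spray_eq hG Su (G u).
by rewrite /ddJ /ext_d subrr => /esym/eqP; rewrite oppr_eq0 => /eqP.
Qed.

Context (nabla Dc : pre_connection M)
  (hnabla : cartan_connection F nabla) (hDc : berwald_connection F Dc)
  (beta : TM -> V -> V * V) (hbeta : horizontal_map nabla beta)
  (A : TM -> V) (hA : concurrent nabla Dc beta A).
Local Notation b := (Bfun F A).

(** The first coordinate term is found by differentiating b = 1/2 dL(gamma A) along beta eta, where
    db = - F^2 and the motion of A is known from the torsion; the second by differentiating Euler's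
    relation along beta A, where dL = 0. The two are equal. *)
Lemma ddJ_energy_horizontal u : slit M u ->
  ddJ L u (beta u (etabar u)) (beta u (A u)) = 0.
Proof.
move=> su; have ac := atlas_at hM u.1.
have hHy : (beta u (etabar u)).1 = etabar u by exact: (hmap_rho hbeta _ su).
have hYA : (beta u (A u)).1 = A u by exact: (hmap_rho hbeta _ su).
have e0 := ddJE hM (beta u (etabar u)) (beta u (A u)) (mopen_slit hM)
  (smooth_energy hM hF) su.
rewrite hHy hYA in e0; rewrite e0 {e0}.
have e1 := dfun_Bfun hM hF (conc_smooth hA) (beta u (etabar u)) su.
rewrite (dfun_Bfun_horizontal hM hF hnabla hbeta hA su) in e1.
rewrite (derive_concurrent_horizontal hM hnabla hbeta hA su) in e1.
have e2 := derive_euler hM hF (beta u (A u)) ac (slit_image_at hM su).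
rewrite (coord_at_snd hM) in e2.
have e3 : 'D_(beta u (A u)) (hat L u) q_[u] = 0.
  exact (dfun_energy_horizontal hM hF hnabla hbeta (A u) su).
have e4 := etrans e2 (congr1 (fun a => 2 * a) e3); rewrite mulr0 in e4.
have e5 := euler hM hF ac (slit_image_at hM su).
rewrite (coord_at_snd hM) -[tangent_chart _]/(chart_at u) (param_at hM) in e5.
have dL : differentiable (hat L u) q_[u].
  exact (smooth_on_differentiable (@smooth_energy_at _ _ _ hM _ hF u)
    (slit_image_at hM su)).
have e6 : 'D_(0, (beta u (A u)).2 - etabar u) (hat L u) q_[u] =
    'D_(0, (beta u (A u)).2) (hat L u) q_[u] - 'D_(0, u.2) (hat L u) q_[u].
  have e : (0, (beta u (A u)).2 - etabar u) =
      (0, (beta u (A u)).2) + (-1) *: (0, u.2) :> V * V.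
    by rewrite -verticalZ -verticalD scaleN1r.
  rewrite e (deriveDv _ _ dL) (deriveZv _ _ dL).
  by rewrite scaleN1r.
exact (energy_balance e1 e4 e5 e6).
Qed.

(** Write G = beta eta + gamma v. The spray equation evaluated at beta A reads 2 g(v, A) = - dL(beta
    A) = 0, so the vertical part contributes db(gamma v) = g(A, v) = 0. *)
Lemma dfun_Bfun_spray G u : canonical_spray (slit M) F G -> slit M u ->
  dfun b u (G u) = - F u ^+ 2.
Proof.
move=> hG su.
have hGy := spray_fst hG su.
have hHy : (beta u (etabar u)).1 = etabar u by exact: (hmap_rho hbeta _ su).
have hYA : (beta u (A u)).1 = A u by exact: (hmap_rho hbeta _ su).
pose v := (G u).2 - (beta u (etabar u)).2.
have eG : G u = beta u (etabar u) + gam v.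
  by apply: injective_projections; rewrite /= ?hGy ?hHy ?addr0 // addrC subrK.
have d1 := spray_eq hG su (beta u (A u)).
rewrite (dfun_energy_horizontal hM hF hnabla hbeta (A u) su) oppr0 eG in d1.
rewrite (ddJDl hM _ _ _ (mopen_slit hM) (smooth_energy hM hF) su) in d1.
rewrite (ddJ_energy_horizontal su) add0r (ddJ_energy_vertical _ _ su) hYA in d1.
have v0 : gmet F u v (A u) = 0.
  by move/eqP: d1; rewrite mulf_eq0 pnatr_eq0 => /eqP.
have db : differentiable (hat b u) q_[u].
  have sb := smooth_Bfun hM hF (conc_smooth hA) (atlas_at hT u).
  exact (smooth_on_differentiable sb (slit_image_at hM su)).
have Av u' z' := concurrent_vertical hM hDc hbeta hA z' (u := u').
rewrite eG (dfunD _ _ db) (dfun_Bfun_horizontal hM hF hnabla hbeta hA su).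
rewrite (dfun_Bfun_vertical hM hF (conc_smooth hA) Av v su).
by rewrite (gmetC hM hF _ _ su) v0 addr0.
Qed.

End Spray.

(** * The golden metric *)

(** The letters f, g, a, T stand for F, b, A^2, Ft at a point; fX, fY, fJX, fJY for dF on X, Y, JX,
    JY, and similarly with g and T; phi and tau for dd_J F and dd_J Ft on (X, Y). The quantified
    hypothesis is the differential of F (Ft + F + b) = b^2 on the four vectors. The conclusion is
    half of the spray equation for Ft^2. *)
Lemma golden_spray_identity (K : realFieldType)
    (f g a T E1 E2 fX gX TX fY gY TY fJY gJY TJY fJX gJX TJX phi tau : K) :
  f != 0 -> g ^+ 2 - g * f - f ^+ 2 != 0 ->
  f ^+ 2 * (1 - 2 * a) + 3 * g ^+ 2 != 0 ->
  E1 = (f ^+ 2 * (f ^+ 3 + 3 * f * g ^+ 2 - 4 * g ^+ 3))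
    / ((g ^+ 2 - g * f - f ^+ 2) * (f ^+ 2 * (1 - 2 * a) + 3 * g ^+ 2)) ->
  E2 = 2 * f ^+ 4 / (f ^+ 2 * (1 - 2 * a) + 3 * g ^+ 2) ->
  T = g ^+ 2 / f - f - g ->
  f * fX = - (E1 * f ^+ 2) - E2 * g ->
  gX = - f ^+ 2 - E1 * g - E2 * a ->
  fJX = f -> gJX = g ->
  (forall FZ GZ TZ, (FZ, GZ, TZ) \in
      [:: (fX, gX, TX); (fY, gY, TY); (fJX, gJX, TJX); (fJY, gJY, TJY)] ->
    f * (TZ + FZ + GZ) + (T + f + g) * FZ = 2 * g * GZ) ->
  fX * fJY - fY * fJX + f * phi = - (f * fY) - E1 * (f * fJY) - E2 * gJY ->
  phi * (T + f + g) + fJY * (TX + fX + gX) + fX * (TJY + fJY + gJY)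
    - fJX * (TY + fY + gY) - fY * (TJX + fJX + gJX) + f * (tau + phi) =
    2 * (gX * gJY - gY * gJX) ->
  TX * TJY - TY * TJX + T * tau = - (T * TY).
Proof.
move=> f0 d0 z0 e1 e2 eT efX egX efJX egJX eZ ephi etau.
have div x y : f * x = y -> x = y / f by move=> <-; rewrite mulrC mulKf.
(* Each differentiated relation is solved for dFt, with T + f + g replaced by g^2 / f. *)
have TZ FZ GZ tz : (FZ, GZ, tz) \in
      [:: (fX, gX, TX); (fY, gY, TY); (fJX, gJX, TJX); (fJY, gJY, TJY)] ->
    tz = (2 * g * GZ - g ^+ 2 / f * FZ) / f - FZ - GZ.
  move=> /eZ h; have -> : g ^+ 2 / f = T + f + g by rewrite eT; ring.
  have /div : f * (tz + FZ + GZ) = 2 * g * GZ - (T + f + g) * FZ by rewrite -h; ring.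
  by move=> <-; ring.
have hX := TZ fX gX TX; have hY := TZ fY gY TY.
have hJX := TZ fJX gJX TJX; have hJY := TZ fJY gJY TJY.
rewrite !inE !eqxx ?orbT /= in hX hY hJX hJY.
have {}hX := hX isT; have {}hY := hY isT; have {}hJX := hJX isT; have {}hJY := hJY isT.
have /div hfX := efX.
have /div hphi : f * phi = - (f * fY) - E1 * (f * fJY) - E2 * gJY -
  (fX * fJY - fY * fJX) by rewrite -ephi; ring.
have /div htau : f * (tau + phi) = 2 * (gX * gJY - gY * gJX) -
    (phi * (T + f + g) + fJY * (TX + fX + gX) + fX * (TJY + fJY + gJY)
    - fJX * (TY + fY + gY) - fY * (TJX + fJX + gJX)) by rewrite -etau; ring.
have {}htau : tau = (2 * (gX * gJY - gY * gJX) -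
    (phi * (T + f + g) + fJY * (TX + fX + gX) + fX * (TJY + fJY + gJY)
    - fJX * (TY + fY + gY) - fY * (TJX + fJX + gJX))) / f - phi.
  by rewrite -htau addrK.
rewrite htau hphi hX hY hJX hJY efJX egJX hfX egX eT e1 e2.
field.
by rewrite f0 d0 z0.
Qed.

(** * Sum and product rules for second derivatives and for dd_J *)

Section SecondDerivatives.
Context {R : realType} {U : normedModType R} (O : set U) (oO : open O).
Implicit Types (f g : U -> R) (X Z : U).

Lemma derive_mul f g q Z : smooth_on O f -> smooth_on O g -> O q ->
  'D_Z (fun x => f x * g x) q = f q * 'D_Z g q + g q * 'D_Z f q.
Proof.
move=> sf sg Oq.
exact (deriveM (diff_derivable (v := Z) (smooth_on_differentiable sf Oq))
  (diff_derivable (v := Z) (smooth_on_differentiable sg Oq))).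
Qed.

Lemma derive_add f g q Z : smooth_on O f -> smooth_on O g -> O q ->
  'D_Z (fun x => f x + g x) q = 'D_Z f q + 'D_Z g q.
Proof.
move=> sf sg Oq.
exact (deriveD (diff_derivable (v := Z) (smooth_on_differentiable sf Oq))
  (diff_derivable (v := Z) (smooth_on_differentiable sg Oq))).
Qed.

Lemma derive2_mul f g q X Z : smooth_on O f -> smooth_on O g -> O q ->
  'D_X ('D_Z (fun x => f x * g x)) q =
  f q * 'D_X ('D_Z g) q + 'D_Z g q * 'D_X f q +
  (g q * 'D_X ('D_Z f) q + 'D_Z f q * 'D_X g q).
Proof.
move=> sf sg Oq.
have s1 := smooth_on_mul oO sf (smooth_on_derive Z sg).
have s2 := smooth_on_mul oO sg (smooth_on_derive Z sf).
apply: etrans (eq_on_derive X oO (fun p Op => derive_mul Z sf sg Op) Oq) _.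
apply: etrans (derive_add X s1 s2 Oq) _.
exact (congr2 (fun a b => a + b)
  (derive_mul X sf (smooth_on_derive Z sg) Oq)
  (derive_mul X sg (smooth_on_derive Z sf) Oq)).
Qed.

Lemma derive2_add f g q X Z : smooth_on O f -> smooth_on O g -> O q ->
  'D_X ('D_Z (fun x => f x + g x)) q = 'D_X ('D_Z f) q + 'D_X ('D_Z g) q.
Proof.
move=> sf sg Oq.
apply: etrans (eq_on_derive X oO (fun p Op => derive_add Z sf sg Op) Oq) _.
exact (derive_add X (smooth_on_derive Z sf) (smooth_on_derive Z sg) Oq).
Qed.

End SecondDerivatives.

Section DdJAlgebra.
Context {R : realType} {n : nat} (M : charted 'rV[R]_n) (hM : smooth_atlas M).
Local Notation V := 'rV[R]_n.
Local Notation TM := (tangent M).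
Let hT := smooth_atlas_tangent hM.
Context (S : set TM) (oS : mopen S).
Implicit Types (u : TM) (X Y : V * V) (f g : TM -> R).

Lemma smooth_fun_add f g : smooth_fun S f -> smooth_fun S g ->
  smooth_fun S (fun w => f w + g w).
Proof. move=> sf sg C aC; exact: (smooth_on_add (oS aC) (sf _ aC) (sg _ aC)). Qed.

Lemma dfun_mul f g u X : smooth_fun S f -> smooth_fun S g -> S u ->
  dfun (fun w => f w * g w) u X = f u * dfun g u X + g u * dfun f u X.
Proof.
move=> sf sg Su; have aC := atlas_at hT u.
have e := derive_mul X (sf _ aC) (sg _ aC) (tangent_image_at hM Su).
apply: etrans e _; rewrite /comp (param_at hM).
by [].
Qed.

Lemma dfun_add f g u X : smooth_fun S f -> smooth_fun S g -> S u ->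
  dfun (fun w => f w + g w) u X = dfun f u X + dfun g u X.
Proof.
move=> sf sg Su; have aC := atlas_at hT u.
exact (derive_add X (sf _ aC) (sg _ aC) (tangent_image_at hM Su)).
Qed.

Lemma ddJ_add f g u X Y : smooth_fun S f -> smooth_fun S g -> S u ->
  ddJ (fun w => f w + g w) u X Y = ddJ f u X Y + ddJ g u X Y.
Proof.
move=> sf sg Su; have aC := atlas_at hT u; have Oq := tangent_image_at hM Su.
have e0 := ddJE hM X Y oS (smooth_fun_add sf sg) Su.
have e1 := ddJE hM X Y oS sf Su; have e2 := ddJE hM X Y oS sg Su.
apply: (etrans e0); rewrite e1 e2 [RHS]addrACA -opprD.
exact (congr2 (fun a b => a - b)
  (derive2_add (oS aC) X (0, Y.1) (sf _ aC) (sg _ aC) Oq)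
  (derive2_add (oS aC) Y (0, X.1) (sf _ aC) (sg _ aC) Oq)).
Qed.

(** This is d applied to d_J (f g) = f d_J g + g d_J f, with the wedge products df ^ d_J g and dg ^
    d_J f written out on (X, Y). *)
Lemma ddJ_mul f g u X Y : smooth_fun S f -> smooth_fun S g -> S u ->
  ddJ (fun w => f w * g w) u X Y =
  dfun f u X * dJ g u Y - dfun f u Y * dJ g u X
  + (dfun g u X * dJ f u Y - dfun g u Y * dJ f u X)
  + f u * ddJ g u X Y + g u * ddJ f u X Y.
Proof.
move=> sf sg Su; have aC := atlas_at hT u; have Oq := tangent_image_at hM Su.
have e0 := ddJE hM X Y oS (smooth_fun_mul oS sf sg) Su.
have e1 := ddJE hM X Y oS sf Su; have e2 := ddJE hM X Y oS sg Su.
apply: (etrans e0); rewrite e1 e2.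
have e3 := derive2_mul (oS aC) X (0, Y.1) (sf _ aC) (sg _ aC) Oq.
have e4 := derive2_mul (oS aC) Y (0, X.1) (sf _ aC) (sg _ aC) Oq.
rewrite /comp (param_at hM) in e3 e4.
apply: etrans (congr2 (fun a b => a - b) e3 e4) _.
rewrite /dJ /dfun /J /gam /rho /comp.
have alg (f0 g0 fX fY gX gY fJX fJY gJX gJY fXY fYX gXY gYX : R) :
    f0 * gXY + gJY * fX + (g0 * fXY + fJY * gX) -
    (f0 * gYX + gJX * fY + (g0 * fYX + fJX * gY)) =
    fX * gJY - fY * gJX + (gX * fJY - gY * fJX) + f0 * (gXY - gYX)
    + g0 * (fXY - fYX) by ring.
exact: alg.
Qed.

Lemma ddJ_ext f g u X Y : (forall w, S w -> f w = g w) -> smooth_fun S f ->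
  smooth_fun S g -> S u -> ddJ f u X Y = ddJ g u X Y.
Proof.
move=> fg sf sg Su; have aC := atlas_at hT u; have Oq := tangent_image_at hM Su.
have e1 := ddJE hM X Y oS sf Su; have e2 := ddJE hM X Y oS sg Su.
have E p : (coord (chart_at u) @` (S `&` dom (chart_at u))) p ->
    (f \o param (chart_at u)) p = (g \o param (chart_at u)) p.
  by move=> Op; have [d s e] := tangent_imageP hM (atlas_at hM u.1) Op; exact: fg.
have E2 Z p : (coord (chart_at u) @` (S `&` dom (chart_at u))) p ->
    'D_Z (f \o param (chart_at u)) p = 'D_Z (g \o param (chart_at u)) p.
  exact: eq_on_derive (oS aC) E.
apply: (etrans e1); rewrite e2.
exact (congr2 (fun a b => a - b) (eq_on_derive X (oS aC) (E2 (0, Y.1)) Oq)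
  (eq_on_derive Y (oS aC) (E2 (0, X.1)) Oq)).
Qed.

End DdJAlgebra.

(** The hypothesis is [ddJ_mul] on both sides of F S = b^2 with S = Ft + F + b; its zeros are the
    values of dd_J b. *)
Lemma product_identity (K : comRingType)
    (f s phi fX fY fJX fJY sX sY sJX sJY ds c dX dY dJX dJY : K) :
  fX * sJY - fY * sJX + (sX * fJY - sY * fJX) + f * (ds + 0) + s * phi =
    dX * dJY - dY * dJX + (dX * dJY - dY * dJX) + c * 0 + c * 0 ->
  phi * s + fJY * sX + fX * sJY - fJX * sY - fY * sJX + f * ds =
    2 * (dX * dJY - dY * dJX).
Proof. by rewrite !mulr0 !addr0 => h; rewrite mulr_natl mulr2n -h; ring. Qed.

Lemma square_identity (K : comRingType) (c tX tJY tY tJX tau : K) :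
  tX * tJY - tY * tJX + c * tau = - (c * tY) ->
  tX * tJY - tY * tJX + (tX * tJY - tY * tJX) + c * tau + c * tau =
    - (c * tY + c * tY).
Proof. by move=> h; rewrite opprD -h; ring. Qed.

(** Halves dd_J F^2 (X, Y), expanded on the left by [ddJ_mul] and on the right by the spray equation
    of F and the metric. *)
Lemma half_identity (K : realFieldType) (p r q s1 s2 t1 t2 : K) :
  p + p + r + r = - (2 * q) + 2 * (- s1 * t1 - s2 * t2) ->
  p + r = - q - s1 * t1 - s2 * t2.
Proof. by move=> h; lra. Qed.

(** * The spray equation of the golden metric *)

Section GoldenSpray.
Context {R : realType} {n : nat} (M : charted 'rV[R]_n) (hM : smooth_atlas M).
Local Notation V := 'rV[R]_n.
Local Notation TM := (tangent M).
Let hT := smooth_atlas_tangent hM.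
Implicit Types (u w : TM) (v z : V) (X Y : V * V).

Lemma smooth_fun_sub (S S' : set TM) (f : TM -> R) :
  S' `<=` S -> smooth_fun S f -> smooth_fun S' f.
Proof.
move=> SS sf C aC; apply: smooth_on_sub (sf _ aC) => _ [w [S'w dw] <-].
by exists w => //; split=> //; exact: SS.
Qed.

Context (F : TM -> R) (hF : finsler F) (nabla Dc : pre_connection M)
  (hnabla : cartan_connection F nabla) (hDc : berwald_connection F Dc)
  (beta : TM -> V -> V * V) (hbeta : horizontal_map nabla beta)
  (A : TM -> V) (hA : concurrent nabla Dc beta A)
  (W : set TM) (hW : conic_finsler W (golden F A))
  (hZ : forall u, W u -> calZ F A u != 0)
  (G : TM -> V * V) (hG : canonical_spray (slit M) F G).
Local Notation L := (sq F).
Local Notation b := (Bfun F A).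
Local Notation T := (golden F A).

(** Both corrections are gathered in a single vertical lift, to which [ddJ_energy_vertical]
    applies. *)
Definition golden_spray u : V * V :=
  G u + gam ((- calE1 F A u) *: etabar u + (- calE2 F A u) *: A u).

Lemma golden_spray_eq u Y : W u ->
  ddJ (sq T) u (golden_spray u) Y = - dfun (sq T) u Y.
Proof.
move=> Wu; have oW := cf_open hW; have su := cf_slit hW Wu.
have sA := conc_smooth hA.
have Av u' z' := concurrent_vertical hM hDc hbeta hA z' (u := u').
have sFs := smooth_finsler hF.
have sF := smooth_fun_sub (cf_slit hW) sFs.
have sb := smooth_fun_sub (cf_slit hW) (smooth_Bfun hM hF sA).
have sT := cf_smooth hW.
have f0 w : slit M w -> F w != 0.
  by move=> sw; rewrite gt_eqF // (cf_pos (fin_slit hF) sw).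
have fu0 := f0 u su.
have half (x : R) : 2^-1 * (2 * x) = x by rewrite mulKf // pnatr_eq0.
pose E1 := calE1 F A u; pose E2 := calE2 F A u.
pose w0 := (- E1) *: etabar u + (- E2) *: A u.
pose X := golden_spray u.
have Xy : X.1 = etabar u by rewrite /X /= (spray_fst hG su) addr0.
have JX : J X = gam (etabar u) by rewrite /J /rho Xy.
have dFb (h : TM -> R) : smooth_fun (slit M) h ->
    differentiable (h \o param (chart_at (c := TM) u)) (coord (chart_at (c := TM) u) u).
  move=> sh; exact (smooth_on_differentiable (sh _ (atlas_at hT u))
    (slit_image_at hM su)).
have dL Z : dfun L u Z = 2 * (F u * dfun F u Z).
  apply: etrans (dfun_mul hM Z sFs sFs su) _; ring.
have gy v : gmet F u (etabar u) v = F u * dfun F u (0, v).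
  by rewrite (gmet_eta hM hF v su) dL; exact: half.
have gA v : gmet F u (A u) v = dfun b u (0, v).
  by rewrite (dfun_Bfun_vertical hM hF sA Av v su).
have fJX : dfun F u (J X) = F u.
  apply: (mulfI fu0); rewrite JX -gy (gmet_eta_eta hM hF su). exact (expr2 (F u)).
have gJX : dfun b u (J X) = b u by rewrite JX -gA.
have gw0 v : gmet F u w0 v = - E1 * gmet F u (etabar u) v - E2 * gmet F u (A u) v.
  by rewrite (gmetDl hM hF _ _ _ su) !(gmetZl hM hF _ _ _ su) !mulNr.
(* F dF is half of dL, and dL(G) = 0, so only g(eta, w0) remains. *)
have fX : F u * dfun F u X = - (E1 * F u ^+ 2) - E2 * b u.
  have e := dfunD (G u) (gam w0) (dFb _ (smooth_energy hM hF)).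
  rewrite (dfun_spray hG su) add0r in e.
  have e' := gmet_eta hM hF w0 su.
  rewrite (gmetC hM hF _ _ su) gw0 (gmet_eta_eta hM hF su) in e'.
  rewrite dL in e; rewrite -e in e'.
  by apply: etrans (etrans (esym (half _)) (esym e')) _; rewrite mulNr.
have gX : dfun b u X = - F u ^+ 2 - E1 * b u - E2 * normA2 F A u.
  have e := dfunD (G u) (gam w0) (dFb _ (smooth_Bfun hM hF sA)).
  rewrite (dfun_Bfun_spray hM hF hnabla hDc hbeta hA hG su) in e.
  rewrite -gA (gmetC hM hF _ _ su) gw0 (gmetC hM hF (etabar u) _ su) in e.
  have assoc (x y z : R) : x + (- E1 * y - E2 * z) = x - E1 * y - E2 * z by ring.
  exact (etrans e (assoc _ _ _)).
have ephi : dfun F u X * dfun F u (J Y) - dfun F u Y * dfun F u (J X) +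
    F u * ddJ F u X Y =
    - (F u * dfun F u Y) - E1 * (F u * dfun F u (J Y)) - E2 * dfun b u (J Y).
  have e1 := ddJ_mul hM (mopen_slit hM) X Y sFs sFs su.
  have e2 := ddJDl hM (G u) (gam w0) Y (mopen_slit hM) (smooth_energy hM hF) su.
  rewrite (spray_eq hG su) (ddJ_energy_vertical hM hF _ _ su) gw0 gy gA dL in e2.
  exact (half_identity (etrans (esym e1) e2)).
pose S w := T w + F w + b w.
have sS : smooth_fun W S.
  exact (smooth_fun_add oW (smooth_fun_add oW sT sF) sb).
have rel w : W w -> F w * S w = b w * b w.
  move=> Ww; have fw := f0 w (cf_slit hW Ww).
  (* Stating the relation without a quotient leaves only sums and products to differentiate. *)
  by rewrite /S /golden; field.
have dS Z : dfun S u Z = dfun T u Z + dfun F u Z + dfun b u Z.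
  rewrite (dfun_add hM Z (smooth_fun_add oW sT sF) sb Wu).
  by rewrite (dfun_add hM Z sT sF Wu).
have eZ Z : F u * (dfun T u Z + dfun F u Z + dfun b u Z) +
    (T u + F u + b u) * dfun F u Z = 2 * b u * dfun b u Z.
  have e1 := dfun_mul hM Z sF sS Wu; have e2 := dfun_mul hM Z sb sb Wu.
  have e3 := dfun_ext hM Z oW rel Wu.
  rewrite e1 e2 dS in e3; apply: (etrans e3).
  by rewrite -mulrA mulr_natl mulr2n.
have etau : ddJ F u X Y * (T u + F u + b u) +
    dfun F u (J Y) * (dfun T u X + dfun F u X + dfun b u X) +
    dfun F u X * (dfun T u (J Y) + dfun F u (J Y) + dfun b u (J Y)) -
    dfun F u (J X) * (dfun T u Y + dfun F u Y + dfun b u Y) -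
    dfun F u Y * (dfun T u (J X) + dfun F u (J X) + dfun b u (J X)) +
    F u * (ddJ T u X Y + ddJ F u X Y) =
    2 * (dfun b u X * dfun b u (J Y) - dfun b u Y * dfun b u (J X)).
  have e1 := ddJ_mul hM oW X Y sF sS Wu; have e2 := ddJ_mul hM oW X Y sb sb Wu.
  have e3 := ddJ_ext hM oW X Y rel (smooth_fun_mul oW sF sS)
    (smooth_fun_mul oW sb sb) Wu.
  have e4 := ddJ_add hM oW X Y (smooth_fun_add oW sT sF) sb Wu.
  rewrite (ddJ_add hM oW X Y sT sF Wu) in e4.
  have b0 := ddJ_Bfun hM hF sA Av (dfun_normA2 hM hF hnabla hbeta hA) X Y su.
  rewrite e1 e2 e4 b0 /dJ !dS in e3.
  exact (product_identity e3).
have d0 : b u ^+ 2 - b u * F u - F u ^+ 2 != 0.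
  (* This factor of the denominator of E1 is F Ft, a product of positive numbers on W. *)
  have -> : b u ^+ 2 - b u * F u - F u ^+ 2 = F u * T u.
    by rewrite /golden; field.
  by rewrite mulf_neq0 // gt_eqF // (cf_pos hW Wu).
have key : dfun T u X * dfun T u (J Y) - dfun T u Y * dfun T u (J X) +
    T u * ddJ T u X Y = - (T u * dfun T u Y).
  apply: (golden_spray_identity fu0 d0 (hZ Wu) (erefl E1) (erefl E2) (erefl (T u))
    fX gX fJX gJX _ ephi etau).
  by move=> FZ GZ TZ; rewrite !inE => /or4P[] /eqP[-> -> ->]; exact: eZ.
have e1 := ddJ_mul hM oW X Y sT sT Wu; have e2 := dfun_mul hM Y sT sT Wu.
apply: etrans e1 _; apply: etrans _ (esym (congr1 -%R e2)).
exact (square_identity key).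
Qed.

End GoldenSpray.

Theorem theorem3p11 (R : realType) (n : nat) (M : charted 'rV[R]_n)
    (hM : smooth_manifold M)
    (F : tangent M -> R) (hF : finsler F)
    (nabla Dc : pre_connection M)
    (hnabla : cartan_connection F nabla) (hDc : berwald_connection F Dc)
    (beta : tangent M -> 'rV[R]_n -> 'rV[R]_n * 'rV[R]_n)
    (hbeta : horizontal_map nabla beta)
    (A : tangent M -> 'rV[R]_n) (hA : concurrent nabla Dc beta A)
    (W : set (tangent M)) (hW : conic_finsler W (golden F A))
    (hZ : forall u, W u -> calZ F A u != 0)
    (G Gt : tangent M -> 'rV[R]_n * 'rV[R]_n)
    (hG : canonical_spray (slit M) F G)
    (hGt : canonical_spray W (golden F A) Gt) :
  forall u, W u ->
    Gt u = G u - calE1 F A u *: liouville u - calE2 F A u *: gam (A u).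
Proof.
move=> u Wu; have hM' := smooth_manifold_atlas hM.
have oW := cf_open hW; have sG := cf_smooth hW.
have sT : smooth_fun W (sq (golden F A)) := smooth_fun_mul oW sG sG.
suff H : Gt u = golden_spray F A G u.
  rewrite H /golden_spray; apply: injective_projections => /=.
    by rewrite !scaler0 !subr0 addr0.
  by rewrite !scaleNr addrA.
apply/eqP; rewrite -subr_eq0; apply/eqP; apply: (cf_rank hW Wu) => Y.
rewrite /Omega -scaleN1r (ddJDl hM' _ _ _ oW sT Wu) (ddJZl hM' _ _ _ oW sT Wu).
rewrite (spray_eq hGt Wu) (golden_spray_eq hM' hF hnabla hDc hbeta hA hW hZ hG Y Wu).
by rewrite mulN1r subrr mulr0.
Qed.
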